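(* Let $q$ be an odd prime power and $d\ge 2$ an integer. Let $R \subseteq \mathbb{F}_q^*$, and denote $t = |R|$. For any $S \subseteq \mathbb{F}_q^d$ with $|S| \geq 12 t^{1/2}q^{(d+1)/2}$, there is a subset $W \subseteq S$ of size $|W| \geq |S| - 80 t q^{d+1}|S|^{-1}$ such that, for each $x \in W$ and $r \in R$, we have $\#\{y \in W: \|x - y\| = r\} \geq 6^{-1}q^{-1}|S|$.
   Context: For $x=(x_1,\ldots,x_d)\in\mathbb{F}_q^d$, define $\|x\| = x_1^2+\cdots+x_d^2\in\mathbb{F}_q$. $\mathbb{F}_q^*=\mathbb{F}_q\setminus\{0\}$. *)

(* Defs.v *)
From mathcomp Require Import all_boot all_order all_algebra.

Set Implicit Arguments.
Unset Strict Implicit.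
Unset Printing Implicit Defensive.

Import GRing.Theory Num.Theory.
Local Open Scope ring_scope.

(* Not a norm in the metric sense: the value lies in F and may vanish at a
   nonzero vector. *)
Definition sqnorm (F : finFieldType) (d : nat) (x : 'rV[F]_d) : F :=
  \sum_(i < d) x 0 i ^+ 2.

(* Main.v *)
Require Import Defs.
From mathcomp Require Import all_boot all_order all_algebra all_field.
From mathcomp Require Import ring zify.

Set Implicit Arguments.
Unset Strict Implicit.
Unset Printing Implicit Defensive.

Import Order.TTheory GRing.Theory Num.Theory.
Local Open Scope ring_scope.

(** The heart of the matter is that, for each nonzero radius [r], pairs of points
    at distance [r] are equidistributed: with [q = #|F|] and [e] the number of
    pairs in [A * B] at distance [r],
      [(q e - #|A| #|B|)^2 <= 4 q^(d+1) #|A| #|B|]   ([distance_discrepancy]).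
    Given this, delete from [S], one at a time, any point that has fewer than
    [#|S| / 6q] neighbours at some distance [r] in [R] among the remaining points.
    Suppose that [k], about [50 t q^(d+1) / #|S|], points have been deleted, let
    [W] be what remains, and group the deleted points by the radius blamed for
    their deletion. Each group [B] spans at most [#|B| #|S| / 6q] pairs with
    [W] at that radius, while [#|W|] is still a large part of [#|S|], so the
    discrepancy bound makes [B] small; adding up over [R] gives a number smaller
    than [k]. Hence the process stops earlier, at a set [W] as required
    ([pruning], [low_degree_card], [pruning_arith]).

    The discrepancy bound follows by expanding the indicator of the sphere of
    radius [r] in additive characters ([sphere_fourier]) and applying Plancherel
    and Cauchy-Schwarz. Completing squares shows that the Fourier coefficients are
    Kloosterman sums [sum_(x != 0) chi (x + c / x)] when [d] is even, and sums of
    the same shape weighted by a quadratic Gauss sum (Salie sums) when [d] is odd.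
    The latter can be evaluated ([salie_bound]). For the former one needs the
    bound [2 sqrt q] of Weil, [kloosterman_bound].

    Weil's bound is proved by elementary means. Over the quadratic extension [E']
    of [E] the Kloosterman sum becomes [2 #|E| - K^2] ([kloosterman_quadratic]).
    So if [|K| > 2 sqrt q] over [F], then along a tower of quadratic extensions
    [E] the ratio of [- K_E] to [sqrt #|E|] tends to infinity, whereas any other
    Kloosterman sum over [E] satisfies [- K_E >= - 2 sqrt #|E|]
    ([kloosterman_tower]). This contradicts an upper bound of the form
    [C(q) sqrt #|E|] for the sum of [- K_E] over the nontrivial characters that
    come from [F]. Up to normalisation, that sum counts the solutions of
    [y^2 = (z^q - z)^2 - 4c] over [E] ([sum_kloosterman]), and for this curve,
    whose degree does not grow with [E], Stepanov's polynomial method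
    applies ([stepanov_bound]). *)

(** * Additive characters of a finite field *)

Definition addchar (F : finFieldType) (psi : F -> algC) :=
  [/\ psi 0 = 1, {morph psi : x y / x + y >-> x * y} & exists x, psi x != 1].

(** Compose a coordinate of [F] over its prime field with a primitive [p]-th root
    of unity. *)
Lemma addchar_exists (F : finFieldType) : exists psi : F -> algC, addchar psi.
Proof.
have [p p_pr pcharFp] := finPcharP F.
pose V : vectType 'F_p := pPrimeCharType pcharFp.
have dimV : (0 < \dim {:V})%N.
  rewrite lt0n dimv_eq0; apply/eqP => V0.
  have : (1 : V) \in (0%VS : {vspace V}) by rewrite -V0; exact: memvf.
  by rewrite memv0; apply/negP; exact: oner_neq0 F.
pose lam (x : V) : 'F_p := coord (vbasis {:V}) (Ordinal dimV) x.
have [w prim_w] := C_prim_root_exists (prime_gt0 p_pr).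
exists (fun x => w ^+ (lam x)); split.
- by rewrite /lam linear0.
- move=> x y; have expD (a b : 'F_p) : w ^+ (a + b)%R = w ^+ a * w ^+ b.
    rewrite -exprD -[RHS](prim_expr_mod prim_w) -(val_Fp_nat p_pr).
    by rewrite natrD !natr_Zp.
  by rewrite -expD /lam -linearD.
- exists ((vbasis {:V})`_(Ordinal dimV)).
  rewrite /lam coord_free ?(basis_free (vbasisP _)) // eqxx.
  apply/eqP; rewrite (val_Fp_nat p_pr) modn_small ?prime_gt1 // => w1.
  have := prim_order_dvd prim_w 1.
  by rewrite w1 eqxx dvdn1 => /eqP p1; rewrite p1 in p_pr.
Qed.

(** Translation by [y] multiplies the sum by [chi y], which is not 1. *)
Lemma sum_character_eq0 (V : finZmodType) (chi : V -> algC) (y : V) :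
  {morph chi : u v / u + v >-> u * v} -> chi y != 1 -> \sum_v chi v = 0.
Proof.
move=> chiD chiy; set s := \sum_v _.
have : chi y * s = s.
  rewrite mulr_sumr [RHS](reindex_inj (addrI y)).
  by apply: eq_bigr => v _; rewrite chiD.
move/eqP; rewrite -subr_eq0 -{2}[s]mul1r -mulrBl mulf_eq0 subr_eq0.
by rewrite (negPf chiy) => /eqP.
Qed.

Section AdditiveCharacter.
Variables (F : finFieldType) (psi : F -> algC).
Hypothesis psiP : addchar psi.

Lemma addchar0 : psi 0 = 1. Proof. by case: psiP. Qed.
Lemma addcharD x y : psi (x + y) = psi x * psi y. Proof. by case: psiP. Qed.

Lemma addchar_sumr (I : Type) (r : seq I) (P : pred I) (f : I -> F) :
  psi (\sum_(i <- r | P i) f i) = \prod_(i <- r | P i) psi (f i).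
Proof. exact: (big_morph psi addcharD addchar0). Qed.

Lemma addcharNV x : psi (- x) * psi x = 1.
Proof. by rewrite -addcharD addNr addchar0. Qed.

Lemma addchar_neq0 x : psi x != 0.
Proof. by apply/eqP => p0; have /eqP := addcharNV x; rewrite p0 mulr0 eq_sym oner_eq0. Qed.

Lemma addchar_norm x : `|psi x| = 1.
Proof.
have [p p_pr pcharFp] := finPcharP F.
have psiMn n : psi (x *+ n) = psi x ^+ n.
  by elim: n => [|n IHn]; rewrite ?mulr0n ?addchar0 // mulrS exprS addcharD IHn.
have := psiMn p; rewrite mulrn_pchar // addchar0 => /(congr1 Num.norm).
rewrite normr1 normrX => /esym/eqP.
by rewrite pexpr_eq1 ?prime_gt0 // => /eqP.
Qed.

Lemma addchar_conj x : (psi x)^* = psi (- x).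
Proof.
apply: (mulIf (addchar_neq0 x)); rewrite addcharNV mulrC -normCK addchar_norm.
by rewrite expr1n.
Qed.

Lemma sum_addcharM (a : F) : \sum_x psi (a * x) = (a == 0)%:R * #|F|%:R.
Proof.
case: eqVneq => [->|a_neq0].
  by under eq_bigr do rewrite mul0r addchar0; rewrite sumr_const mul1r.
rewrite mul0r; have [_ _ [y psiy]] := psiP.
apply: (@sum_character_eq0 _ (fun x => psi (a * x)) (a^-1 * y)) => [u v|].
  by rewrite mulrDr addcharD.
by rewrite mulrA mulfV // mul1r.
Qed.

Lemma sum_addchar_dot d (m : 'rV[F]_d) :
  \sum_(v : 'rV[F]_d) psi (\sum_i m 0 i * v 0 i) = (m == 0)%:R * #|F|%:R ^+ d.
Proof.
case: eqVneq => [->|/eqP m_neq0].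
  under eq_bigr do [rewrite big1 ?addchar0; last by move=> i _; rewrite mxE mul0r].
  by rewrite sumr_const mul1r card_mx mul1n natrX.
rewrite mul0r; have [_ _ [y psiy]] := psiP.
have [i mi] : exists i, m 0 i != 0.
  apply/existsP; rewrite -negb_forall; apply/negP => /forallP m0; apply: m_neq0.
  by apply/rowP => i; rewrite mxE; apply/eqP.
pose chi (v : 'rV[F]_d) := psi (\sum_i m 0 i * v 0 i).
apply: (@sum_character_eq0 _ chi ((m 0 i)^-1 * y *: delta_mx 0 i)) => [u v|].
  rewrite /chi -addcharD -big_split /=; congr psi; apply: eq_bigr => j _.
  by rewrite mxE mulrDr.
rewrite /chi (bigD1 i) //= big1 => [|j ji].
  by rewrite !mxE !eqxx mulr1 addr0 mulrA mulfV // mul1r.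
by rewrite !mxE (negPf ji) andbF !mulr0.
Qed.

End AdditiveCharacter.

(** * Stepanov's method for values of a polynomial that are nonsquares *)
Lemma separable_dvdp_sqr (E : fieldType) (f u : {poly E}) :
  separable_poly f -> f %| u ^+ 2 -> f %| u.
Proof.
move=> sep_f; have f_neq0 := separable_poly_neq0 sep_f.
have [-> _|u_neq0] := eqVneq u 0; first by rewrite dvdp0.
pose g := gcdp f u; have g_neq0 : g != 0 by rewrite gcdp_eq0 negb_and f_neq0.
have fE : f = f %/ g * g by rewrite divpK ?dvdp_gcdl.
have uE : u = u %/ g * g by rewrite divpK ?dvdp_gcdr.
have co_hg : coprimep (f %/ g) g by apply: separable_coprime sep_f _; rewrite -fE.
have co_hu : coprimep (f %/ g) (u %/ g) by apply: coprimep_div_gcd; rewrite f_neq0.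
have -> : u ^+ 2 = u %/ g * u * g by rewrite expr2 {1}uE mulrAC.
rewrite {1}fE dvdp_mul2r // Gauss_dvdpr // => h_u.
by rewrite {1}fE Gauss_dvdp // h_u dvdp_gcdr.
Qed.

(** A separable nonconstant [f] is not a square up to a scalar, even in the field
    of fractions: [f] divides [u], hence [v], and dividing both by [f] gives an
    infinite descent on the size of [v]. *)
Lemma separable_not_sqr (E : fieldType) (f u v : {poly E}) (c : E) :
  separable_poly f -> (1 < size f)%N -> c != 0 ->
  u ^+ 2 = c *: (v ^+ 2 * f) -> v = 0.
Proof.
move=> sep_f f_gt1 c_neq0; have f_neq0 := separable_poly_neq0 sep_f.
elim: {v}(size v) {-2}v (leqnn (size v)) u => [|k IHk] v.
  by rewrite leqn0 size_poly_eq0 => /eqP.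
move=> v_le u uv; apply/eqP/contraT => v_neq0.
have /dvdpP[u1 u1E] : f %| u.
  by apply: separable_dvdp_sqr; rewrite // uv dvdpZr // dvdp_mull.
have u1v : u1 ^+ 2 * f = c *: v ^+ 2.
  apply: (mulIf f_neq0); rewrite -scalerAl -uv u1E; ring.
have /dvdpP[v1 v1E] : f %| v.
  apply: separable_dvdp_sqr; rewrite // -(dvdpZr _ _ c_neq0) -u1v dvdp_mull //.
have v1_neq0 : v1 != 0 by apply: contraNneq v_neq0 => v10; rewrite v1E v10 mul0r.
suff /eqP : v1 = 0 by rewrite (negPf v1_neq0).
apply: (IHk _ _ u1).
  rewrite -ltnS (leq_trans _ v_le) // v1E size_mul //.
  by case: (size f) f_gt1 => [|[|m]] // _; rewrite !addnS /= ltnS leq_addr.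
apply: (mulIf f_neq0); rewrite u1v v1E -scalerAl; congr (_ *: _); ring.
Qed.

(** There are more coefficient families than polynomials of size at most [N], so
    two families give the same combination; take their difference. *)
Lemma poly_family_dependent (E : finFieldType) (T : finType) N (b : T -> {poly E}) :
  (forall t, size (b t) <= N)%N -> (N < #|T|)%N ->
  exists g : T -> E, (exists t, g t != 0) /\ \sum_t g t *: b t = 0.
Proof.
move=> b_le N_lt.
pose phi (g : {ffun T -> E}) : 'rV[E]_N := poly_rV (\sum_t g t *: b t).
have /injectivePn[g1 [g2 g12 phi12]] : ~~ injectiveb phi.
  apply/negP => /injectiveP/leq_card; rewrite card_ffun card_mx mul1n.
  by rewrite leqNgt ltn_exp2l ?N_lt ?finNzRing_gt1 ?card_finNzRing_gt1.
exists (fun t => g1 t - g2 t); split.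
  apply/existsP; rewrite -negb_forall; apply: contra g12 => /forallP g12.
  by apply/eqP/ffunP => t; apply/eqP; rewrite -subr_eq0.
have sz (g : T -> E) : (size (\sum_t g t *: b t)%R <= N)%N.
  apply: (leq_trans (poly.size_sum _ _ _)); apply/bigmax_leqP => t _.
  exact: leq_trans (size_scale_leq _ _) (b_le t).
move/(congr1 rVpoly): phi12; rewrite !poly_rV_K // => phi12.
under eq_bigr do rewrite scalerBl.
by rewrite sumrB phi12 subrr.
Qed.

Section Nonvanishing.
Variables (E : fieldType) (f : {poly E}) (n h I : nat).
Hypotheses (n_pchar : [pchar E].-nat n) (n_odd : n.+1 = h.*2).
Hypotheses (f0 : f.[0] != 0) (f_sep : separable_poly f) (f_gt1 : (1 < size f)%N).
Hypothesis I_le : (I.-1.*2 + size f <= n)%N.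

(** For [n] a power of the characteristic, taking [n]-th powers is additive, so
    [f^n] is constant modulo [X^n]. *)
Lemma frobenius_trunc : exists g, f ^+ n = (f.[0] ^+ n)%:P + 'X^n * g.
Proof.
have : root (f - f.[0]%:P) 0 by rewrite rootE !hornerE subrr.
rewrite -dvdp_XsubCl subr0 => /dvdpP[g gE]; exists (g ^+ n).
have fE : f = f.[0]%:P + 'X * g by rewrite mulrC -gE addrC subrK.
rewrite {1}fE exprDn_pchar ?(eq_pnat _ (pchar_poly _)) //.
by rewrite exprMn polyC_exp.
Qed.

(** Non-vanishing of the auxiliary polynomial. If the lowest blocks satisfied
    [u_0 + v_0 f^h = 0] modulo [X^n], then multiplying by the conjugate
    [u_0 - v_0 f^h] and using [2 h = n + 1] would give
    [u_0^2 = f(0)^n v_0^2 f] modulo [X^n]; the sizes are so small that this is an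
    equality of polynomials, which [separable_not_sqr] forbids. Then divide by
    [X^n] and continue with the next block. *)
Lemma frobenius_combination_free J (u v : nat -> {poly E}) :
  (forall j, size (u j) <= I)%N -> (forall j, size (v j) <= I)%N ->
  \sum_(j < J) (u j + v j * f ^+ h) * 'X^(j * n) = 0 ->
  forall j, (j < J)%N -> u j = 0 /\ v j = 0.
Proof.
elim: J u v => [//|J IHJ] u v u_le v_le.
rewrite big_ord_recl /= mul0n expr0 mulr1.
under eq_bigr do rewrite /bump /= mulSn exprD mulrA mulrAC.
rewrite -mulr_suml; set s := \sum_(i < J) _ => uv0.
have Xn_neq0 : 'X^n != 0 :> {poly E} by rewrite monic_neq0 ?monicXn.
have [u0 v0] : u 0%N = 0 /\ v 0%N = 0.
  (* [w] is [(u_0 + v_0 f^h) (u_0 - v_0 f^h)] with [f^n] replaced by its constant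
     term. *)
  pose c := f.[0] ^+ n; have c_neq0 : c != 0 by rewrite expf_neq0.
  have [g gE] := frobenius_trunc.
  pose w := u 0%N ^+ 2 - c *: (v 0%N ^+ 2 * f).
  have w_dvd : 'X^n %| w.
    have fh : f ^+ h * f ^+ h = f * (c%:P + 'X^n * g).
      by rewrite -gE -exprD addnn -n_odd exprS.
    have -> : w = 'X^n * (v 0%N ^+ 2 * f * g - s * (u 0%N - v 0%N * f ^+ h)).
      have uvE : u 0%N + v 0%N * f ^+ h = - (s * 'X^n).
        by apply/eqP; rewrite -addr_eq0 uv0.
      have u2E : u 0%N ^+ 2 = (u 0%N + v 0%N * f ^+ h) * (u 0%N - v 0%N * f ^+ h)
                            + v 0%N ^+ 2 * (f ^+ h * f ^+ h) by ring.
      by rewrite /w u2E uvE fh -mul_polyC; ring.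
    by rewrite dvdp_mulr.
  have w0 : w = 0.
    apply/eqP; apply: contraT => w_neq0.
    have := dvdp_leq w_neq0 w_dvd; rewrite size_polyXn ltnNge.
    rewrite (leq_trans _ I_le) // (leq_trans (size_polyD _ _)) // geq_max.
    rewrite size_polyN; apply/andP; split.
      apply: leq_trans (size_poly_exp_leq _ _) _.
      by move: (u_le 0%N) f_gt1; move: (size f) (size (u 0%N)) => sf su; lia.
    apply: leq_trans (size_scale_leq _ _) _.
    apply: leq_trans (size_polyMleq _ _) _.
    move: (size_poly_exp_leq (v 0%N) 2) (v_le 0%N) f_gt1.
    by move: (size f) (size (v 0%N)) (size (v 0%N ^+ 2)) => sf sv sv2; lia.
  have v0 : v 0%N = 0.
    apply: (separable_not_sqr (u := u 0%N) f_sep f_gt1 c_neq0).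
    by apply/eqP; rewrite -subr_eq0 -/w w0.
  split=> //; apply/eqP; move/eqP: w0.
  by rewrite /w v0 expr0n mul0r scaler0 subr0 sqrf_eq0.
move: uv0; rewrite u0 v0 mul0r !add0r => /eqP.
rewrite mulf_eq0 (negPf Xn_neq0) orbF => /eqP s0.
have {}IHJ := IHJ (fun j => u j.+1) (fun j => v j.+1)
                 (fun j => u_le _) (fun j => v_le _) s0.
by case=> [_|j jJ] //; apply: IHJ.
Qed.

End Nonvanishing.

(** Write [h = (n + 1) / 2]. The auxiliary polynomial is
      [A = sum g_(i,j,c)^n X^(i + j n) f^(h c)].
    For [x] in [E] one has [x^(n^2) = x], and if moreover
    [f(x)^((n^2 - 1) / 2) = -1] then [(f(x)^h)^n = - f(x)^h]. Hence [A(x)^n] is the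
    value at [x] of
      [sum g_(i,j,c) X^(i n + j) (- f^h)^c],
    in which the roles of [i] and [j] are exchanged. The coefficients [g] are
    chosen to make this second polynomial, of small degree, vanish identically;
    so every such [x] is a root of [A]. *)
Lemma stepanov_count (E : finFieldType) (f : {poly E}) (n h I J N : nat) :
  [pchar E].-nat n -> n.+1 = h.*2 -> #|E| = (n ^ 2)%N ->
  f.[0] != 0 -> separable_poly f -> (1 < size f)%N ->
  (I.-1.*2 + size f <= n)%N ->
  (I.-1 * n + J.-1 + (size f).-1 * h < N)%N -> (N < (I * J).*2)%N ->
  (#|[set x : E | (f.[x] ^+ ((n ^ 2).-1)./2 == -1)%R]|
     <= I.-1 + J.-1 * n + (size f).-1 * h)%N.
Proof.
move=> n_pchar n_odd E_card f0 f_sep f_gt1 I_le N_gt N_lt.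
have n_gt0 : (0 < n)%N by case: (n) E_card => // c0; have := finNzRing_gt1 E; rewrite c0.
pose T := ('I_I * 'I_J * bool)%type.
pose b (t : T) : {poly E} :=
  'X^(t.1.1 * n + t.1.2) * (if t.2 then - f ^+ h else 1).
pose a (t : T) : {poly E} :=
  'X^(t.1.1 + t.1.2 * n) * (if t.2 then f ^+ h else 1).
have sz_fh : (size (f ^+ h) <= ((size f).-1 * h).+1)%N by exact: size_poly_exp_leq.
have [||g [g_neq0 bg]] := @poly_family_dependent E T N b.
- move=> [[i j] c]; apply: leq_trans (size_polyMleq _ _) _.
  rewrite size_polyXn addSn /=; apply: leq_trans N_gt; rewrite -addnS leq_add //.
    by rewrite leq_add ?leq_mul2r; have := ltn_ord i; have := ltn_ord j; lia.
  by case: c; rewrite ?size_polyN ?size_poly1.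
- by rewrite !card_prod !card_ord card_bool muln2.
pose A := \sum_t g t ^+ n *: a t.
have szA : (size A <= (I.-1 + J.-1 * n + (size f).-1 * h).+1)%N.
  apply: leq_trans (poly.size_sum _ _ _) _; apply/bigmax_leqP => -[[i j] c] _.
  apply: leq_trans (size_scale_leq _ _) _; apply: leq_trans (size_polyMleq _ _) _.
  rewrite size_polyXn addSn /= -addnS leq_add //.
    by rewrite leq_add ?leq_mul2r; have := ltn_ord i; have := ltn_ord j; lia.
  by case: c; rewrite ?size_polyN ?size_poly1.
have A_neq0 : A != 0.
  pose G c (i j : nat) : E :=
    if (insub i : option 'I_I, insub j : option 'I_J) is (Some i', Some j')
    then g (i', j', c) ^+ n else 0.
  have GE c (i : 'I_I) (j : 'I_J) : G c i j = g (i, j, c) ^+ n by rewrite /G !valK.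
  have AE : A = \sum_(j < J) (\poly_(i < I) G false i j
                   + \poly_(i < I) G true i j * f ^+ h) * 'X^(j * n).
    transitivity (\sum_(i < I) \sum_(j < J) \sum_c g (i, j, c) ^+ n *: a (i, j, c)).
      by rewrite !pair_bigA; apply: eq_bigr => -[[i j] c].
    rewrite exchange_big; apply: eq_bigr => j _ /=.
    rewrite !poly_def mulr_suml -big_split /= mulr_suml; apply: eq_bigr => i _.
    rewrite big_bool /a /= !GE mulr1 exprD mulrDl -!scalerAl addrC.
    by congr (_ + _ *: _); rewrite mulrAC.
  case: g_neq0 => [[[i j] c]] gt_neq0; apply: contraNneq gt_neq0 => A0.
  have [||u0 v0] := frobenius_combination_free n_pchar n_odd f0 f_sep f_gt1 I_le
     (u := fun j => \poly_(i < I) G false i j) (v := fun j => \poly_(i < I) G true i j)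
     _ _ (etrans (esym AE) A0) (ltn_ord j); try by move=> ?; exact: size_poly.
  have : G c i j = 0.
    have [/polyP/(_ i) + /polyP/(_ i)] := (u0, v0).
    by rewrite !coef_poly !ltn_ord !coef0; case: c.
  by move/eqP; rewrite GE expf_eq0 => /andP[].
set S := [set _ | _].
have S_root : all (root A) (enum S).
  apply/allP => x; rewrite mem_enum inE => /eqP fx; rewrite rootE.
  have E_pow y : (y : E) ^+ n ^+ n = y by rewrite -exprM mulnn -E_card expf_card.
  have fxh : f.[x] ^+ h ^+ n = - f.[x] ^+ h.
    have -> : f.[x] ^+ h ^+ n = f.[x] ^+ ((n ^ 2).-1./2 + h).
      rewrite -exprM; congr (_ ^+ _).
      have nE : n = h.-1.*2.+1 by lia.
      have -> : (n ^ 2).-1 = (h.-1 * h).*2.*2 by rewrite nE; lia.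
      by rewrite doubleK nE; lia.
    by rewrite exprD fx mulN1r.
  have : A.[x] ^+ n = (\sum_t g t *: b t).[x].
    rewrite !horner_sum (big_morph (fun y => y ^+ n) (id1 := 0) (op1 := +%R)).
    - apply: eq_bigr => -[[i j] c] _; rewrite !hornerZ exprMn E_pow; congr (_ * _).
      rewrite !hornerM exprMn !hornerXn /=; congr (_ * _).
        rewrite -exprM mulnDl -mulnA [(j * _)%N]mulnC !exprD.
        by rewrite (exprM x (n * n)) (exprM x n) E_pow.
      case: c => /=; rewrite ?hornerN ?horner_exp ?fxh //.
      by rewrite hornerC expr1n.
    - by move=> y z; rewrite exprDn_pchar.
    - by rewrite expr0n eqn0Ngt n_gt0.
  by rewrite bg horner0 => /eqP; rewrite expf_eq0 => /andP[].
have := max_poly_roots A_neq0 S_root (enum_uniq _); rewrite -cardE.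
by move=> /leq_trans/(_ szA); rewrite ltnS.
Qed.

(** Parameters for [stepanov_count]: with [deg f = 2 mu], the largest admissible
    [I] is [(n + 1) / 2 - mu], and [J = (n + 1) / 2 + 2 mu] gives just enough
    unknown coefficients. *)
Lemma stepanov_bound (E : finFieldType) (f : {poly E}) (n mu : nat) :
  [pchar E].-nat n -> odd n -> #|E| = (n ^ 2)%N ->
  f.[0] != 0 -> separable_poly f -> size f = mu.*2.+1 -> (0 < mu)%N -> (4 * mu <= n)%N ->
  (2 * #|[set x : E | (f.[x] ^+ ((n ^ 2).-1)./2 == -1)%R]| <= n ^ 2 + 6 * mu * n)%N.
Proof.
move=> n_pchar n_odd E_card f0 f_sep sz_f mu_gt0 mu_le.
(* With [s = (n - 1) / 2 - 2 mu] all quantities are polynomials in [mu] and [s]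
   with nonnegative coefficients. *)
have [s nE] : exists s, n = (2 * mu + s).*2.+1 by exists (n./2 - 2 * mu)%N; lia.
have := @stepanov_count E f n (2 * mu + s).+1 (mu + s).+1 (4 * mu + s).+1
  ((mu + s).+1 * (4 * mu + s).+1).*2.-1 n_pchar _ E_card f0 f_sep _ _ _ _.
rewrite sz_f /=; set c := #|_| => c_le.
have {c_le} : (c <= (mu + s) + (4 * mu + s) * n + mu.*2 * (2 * mu + s).+1)%N.
  apply: c_le; [lia | lia | lia | | lia].
  rewrite nE; case: (mu) mu_gt0 => // m _; nia.
move=> c_le; rewrite nE in c_le *; nia.
Qed.

(** * Squares in a finite field of odd order *)
Lemma sum_nat_saturated (I : finType) (P : pred I) (f : I -> nat) m i :
  (forall j, P j -> f j <= m)%N -> (#|P| * m <= \sum_(j | P j) f j)%N -> P i -> f i = m.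
Proof.
move=> f_le sum_ge Pi; apply/eqP; rewrite eqn_leq f_le //= leqNgt; apply/negP => f_lt.
have : (\sum_(j | P j) f j < \sum_(j | P j) m)%N.
  rewrite (bigD1 i) //= [X in (_ < X)%N](bigD1 i) //= -addSn leq_add //.
  by apply: leq_sum => j /andP[/f_le].
by rewrite ltnNge sum_nat_const sum_ge.
Qed.

Lemma card_sigma_sum (A B : finType) (P : A -> B -> bool) :
  (\sum_a #|[set b | P a b]| = \sum_b #|[set a | P a b]|)%N.
Proof.
under eq_bigr do rewrite -sum1dep_card big_mkcond.
under [RHS]eq_bigr do rewrite -sum1dep_card big_mkcond.
by rewrite exchange_big.
Qed.

Lemma card_fibers (A B : finType) (f : A -> B) : (\sum_b #|[set a | f a == b]| = #|A|)%N.
Proof.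
rewrite -[RHS]sum1_card (partition_big f predT) //=; apply: eq_bigr => b _.
by rewrite sum1dep_card.
Qed.

Lemma finField_pchar_nat (E : finFieldType) : [pchar E].-nat #|E|.
Proof.
have [p p_pr pcharEp] := finPcharP E.
have /= -> := card_pprimeChar pcharEp; rewrite pnatX; apply/orP; left.
by rewrite pnatE.
Qed.

Section Squares.
Variable E : finFieldType.
Hypothesis E_odd : odd #|E|.

Lemma odd_card_natr2_neq0 : 2 != 0 :> E.
Proof.
apply/negP => E2; have E2' : 2%N \in [pchar E] by rewrite inE /= E2.
have /= E_card := card_pprimeChar E2'; have := finNzRing_gt1 E; move: E_odd.
by rewrite E_card; case: (logn _ _) => // k; rewrite expnS oddM.
Qed.

Lemma addff_eq0 (x : E) : (x + x == 0) = (x == 0).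
Proof. by rewrite -mulr2n -mulr_natr mulf_eq0 (negPf odd_card_natr2_neq0) orbF. Qed.

Lemma nonsquare_exists : exists e : E, forall w, w ^+ 2 != e.
Proof.
have [e e_nsq] : exists e : E, e \notin codom (fun w : E => w ^+ 2).
  apply/existsP; rewrite -negb_forall; apply/negP => /forallP sq_surj.
  have : injective (fun w : E => w ^+ 2).
    apply/injectiveP/card_uniqP; rewrite size_map -cardT.
    by apply: eq_card => e; have := sq_surj e.
  move=> /(_ 1 (-1)); rewrite sqrrN => /(_ erefl)/eqP.
  by rewrite -addr_eq0 (negPf odd_card_natr2_neq0).
by exists e => w; apply: contra e_nsq => /eqP <-; apply: codom_f.
Qed.

Lemma card_sqrt_sqr (b : E) : b != 0 -> #|[set w : E | w ^+ 2 == b ^+ 2]| = 2%N.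
Proof.
move=> b_neq0; have -> : [set w : E | w ^+ 2 == b ^+ 2] = [set b; - b].
  by apply/setP => w; rewrite !inE eqf_sqr.
by rewrite cards2 -addr_eq0 addff_eq0 b_neq0.
Qed.

(** The two sets cannot both contain a nonzero element, because [e] would be a
    square, so their sizes add up to at most 2. Over all [a] the sum of these sizes
    is [2 #|E|], hence equality holds for every [a]. *)
Lemma card_sqrt_nonsquare (e a : E) : (forall w, w ^+ 2 != e) ->
  (#|[set w : E | w ^+ 2 == a]| + #|[set v : E | (e * v ^+ 2 == a)%R]| = 2)%N.
Proof.
move=> e_nsq; have e_neq0 : e != 0.
  by have := e_nsq 0; rewrite expr0n eq_sym.
apply: (@sum_nat_saturated _ predT (fun a => #|[set w : E | w ^+ 2 == a]|
   + #|[set v : E | (e * v ^+ 2 == a)%R]|)%N) => // [{}a _|]; last first.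
  by rewrite big_split /= !card_fibers muln2 addnn.
have [->|a_neq0] := eqVneq a 0.
  have -> : [set w : E | w ^+ 2 == 0] = [set 0].
    by apply/setP => w; rewrite !inE sqrf_eq0.
  have -> : [set v : E | e * v ^+ 2 == 0] = [set 0].
    by apply/setP => w; rewrite !inE mulf_eq0 (negPf e_neq0) sqrf_eq0.
  by rewrite !cards1.
have [->|[b]] := set_0Vmem [set w : E | w ^+ 2 == a].
  rewrite cards0 add0n; have [->|[v]] := set_0Vmem [set v : E | (e * v ^+ 2 == a)%R].
    by rewrite cards0.
  rewrite inE => /eqP vE; have v_neq0 : v != 0.
    by apply: contraNneq a_neq0 => v0; rewrite -vE v0 expr0n mulr0.
  rewrite -[X in (_ <= X)%N](card_sqrt_sqr v_neq0) subset_leq_card //.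
  by apply/subsetP => w; rewrite !inE -vE => /eqP/(mulfI e_neq0) ->.
rewrite inE => /eqP bE; have b_neq0 : b != 0.
  by apply: contraNneq a_neq0 => b0; rewrite -bE b0 expr0n.
have -> : [set v : E | (e * v ^+ 2 == a)%R] = set0.
  apply/setP => v; rewrite !inE; apply/eqP => vE; have v_neq0 : v != 0.
    by apply: contraNneq a_neq0 => v0; rewrite -vE v0 expr0n mulr0.
  have /eqP[] := e_nsq (b / v).
  by rewrite expr_div_n bE -vE mulfK // expf_neq0.
by rewrite cards0 addn0 -bE card_sqrt_sqr.
Qed.

(** Otherwise [a^h = 1] with [h = (#|E| - 1) / 2]. Every nonzero element is a square
    or [a] times a square by [card_sqrt_nonsquare], so all [2 h] of them would be
    roots of [X^h - 1]. *)
Lemma nonsquare_euler (a : E) : (forall w, w ^+ 2 != a) -> a ^+ (#|E|.-1)./2 = -1.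
Proof.
move=> a_nsq; set h := _./2.
have h_card : (#|E|.-1 = h.*2)%N.
  by rewrite /h; have := finNzRing_gt1 E; move: E_odd; case: #|E| => // m; lia.
have E_pow (x : E) : x != 0 -> x ^+ h.*2 = 1.
  move=> x_neq0; apply: (mulfI x_neq0).
  by rewrite -h_card -exprS prednK ?expf_card ?mulr1 // ltnW ?finNzRing_gt1.
have a_neq0 : a != 0.
  by have := a_nsq 0; rewrite expr0n eq_sym.
have := E_pow _ a_neq0; rewrite -muln2 exprM => /eqP.
rewrite sqrf_eq1 => /orP[/eqP ah|/eqP //].
have h_gt0 : (0 < h)%N.
  by move: h_card (finNzRing_gt1 E) E_odd; case: #|E| => [|[|m]] //; case: (h); lia.
have p_neq0 : 'X^h - 1 != 0 :> {poly E} by rewrite monic_neq0 ?monicXnsubC.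
have p_roots : all (root ('X^h - 1 : {poly E})) (enum [set~ (0 : E)]).
  apply/allP => x; rewrite mem_enum !inE => x_neq0.
  rewrite rootE !hornerE subr_eq0; apply/eqP.
  have := card_sqrt_nonsquare x a_nsq.
  have [->|[b]] := set_0Vmem [set w : E | w ^+ 2 == x].
    have [->|[v]] := set_0Vmem [set v : E | a * v ^+ 2 == x]; first by rewrite !cards0.
    rewrite inE => /eqP xE _; have v_neq0 : v != 0.
      by apply: contraNneq x_neq0 => v0; rewrite -xE v0 expr0n mulr0.
    by rewrite -xE exprMn ah mul1r -exprM mulnC muln2 E_pow.
  rewrite inE => /eqP xE _; have b_neq0 : b != 0.
    by apply: contraNneq x_neq0 => v0; rewrite -xE v0 expr0n.
  by rewrite -xE -exprM mulnC muln2 E_pow.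
have := max_poly_roots p_neq0 p_roots (enum_uniq _).
rewrite -cardE cardsC1 size_XnsubC // h_card; lia.
Qed.

End Squares.

Lemma quadratic_extension (E : finFieldType) (e : E) : (forall w, w ^+ 2 != e) ->
  exists (E' : finFieldType) (iota : {rmorphism E -> E'}) (z : E'),
    z ^+ 2 = iota e /\ (#|E'| = #|E| ^ 2)%N.
Proof.
move=> e_nsq; have p_irr : irreducible_poly ('X^2 - e%:P).
  apply: cubic_irreducible; rewrite ?size_XnsubC // => x.
  by rewrite rootE !hornerE subr_eq0.
have [L dimL [z rz _]] := irredp_FAdjoin p_irr.
exists (FinFieldExtType L), (in_alg L), z; split.
  move: rz; rewrite rmorphB /= map_polyXn map_polyC /= rootE !hornerE subr_eq0.
  by move/eqP.
have := @card_vspace E (FinFieldExtType L) (Vector.class L) fullv.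
rewrite card_vspacef => ->; rewrite [X in (_ ^ X)%N](_ : _ = 2%N) //.
by rewrite dimL size_XnsubC.
Qed.

(** * Kloosterman sums under a quadratic extension *)
Definition kloosterman (E : finFieldType) (chi : E -> algC) (c : E) : algC :=
  \sum_(x | x != 0) chi (x + c / x).

(** The substitution of [- x] for [x] conjugates the sum. *)
Lemma kloosterman_real (E : finFieldType) (chi : E -> algC) (c : E) :
  addchar chi -> kloosterman chi c \is Num.real.
Proof.
move=> chiP; rewrite CrealE /kloosterman rmorph_sum /=.
rewrite [eqbRHS](reindex_inj (@oppr_inj _)) /=; apply/eqP.
apply: eq_big => [x|x _]; first by rewrite oppr_eq0.
by rewrite addchar_conj // invrN mulrN opprD.
Qed.

Lemma sum_by_value (A B : finType) (R : nmodType) (h : A -> B) (G : B -> R) (P : pred B) :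
  \sum_(a | P (h a)) G (h a) = \sum_(b | P b) G b *+ #|[set a | h a == b]|.
Proof.
rewrite (partition_big h P) //=; apply: eq_bigr => b Pb.
rewrite -sumr_const; apply: eq_big => [a|a /andP[_ /eqP -> //]].
by rewrite inE andb_idl // => /eqP ->.
Qed.

Section QuadraticStep.
Variables (E E' : finFieldType) (iota : {rmorphism E -> E'}) (e : E) (z : E').
Hypotheses (E_odd : odd #|E|) (e_nsq : forall w, w ^+ 2 != e).
Hypotheses (z_sq : z ^+ 2 = iota e) (E'_card : (#|E'| = #|E| ^ 2)%N).

Definition quad_elt (uv : E * E) : E' := iota uv.1 + iota uv.2 * z.

Lemma quad_norm_eq0 u v : (u ^+ 2 - e * v ^+ 2 == 0) = ((u, v) == (0, 0)).
Proof.
rewrite xpair_eqE; have [->|v_neq0] := eqVneq v 0.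
  by rewrite expr0n mulr0 subr0 sqrf_eq0 andbT.
rewrite andbF subr_eq0; apply/negP => /eqP uE; have /eqP[] := e_nsq (u / v).
by rewrite expr_div_n uE mulfK // expf_neq0.
Qed.

Lemma quad_elt_mulN u v : quad_elt (u, v) * quad_elt (u, - v) = iota (u ^+ 2 - e * v ^+ 2).
Proof.
by rewrite /quad_elt /= rmorphB rmorphN (rmorphM _ e) !rmorphXn -z_sq /=; ring.
Qed.

Lemma quad_elt_bij : bijective quad_elt.
Proof.
apply: inj_card_bij; last by rewrite card_prod E'_card.
have quad0 uv : quad_elt uv = 0 -> uv = (0, 0).
  case: uv => u v uv0; apply/eqP; rewrite -quad_norm_eq0.
  by rewrite -(fmorph_eq0 iota) -quad_elt_mulN uv0 mul0r.
move=> [u v] [u' v'] uv.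
have /quad0/eqP : quad_elt (u - u', v - v') = 0.
  move/eqP: uv; rewrite -subr_eq0 => /eqP <-.
  by rewrite /quad_elt /= !rmorphB; ring.
by rewrite xpair_eqE !subr_eq0 => /andP[/eqP -> /eqP ->].
Qed.

Lemma quad_elt_inv u v : (u, v) != (0, 0) ->
  let N := u ^+ 2 - e * v ^+ 2 in (quad_elt (u, v))^-1 = quad_elt (u / N, - v / N).
Proof.
move=> uv_neq0 N; have N_neq0 : N != 0 by rewrite quad_norm_eq0.
have N_neq0' : iota N != 0 by rewrite fmorph_eq0.
have uvN := quad_elt_mulN u v; have uv_neq0' : quad_elt (u, v) != 0.
  by apply: contraNneq N_neq0' => uv0; rewrite -uvN uv0 mul0r.
apply: (mulfI uv_neq0'); rewrite mulfV //; apply: (mulIf N_neq0').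
rewrite mul1r -{1}uvN -mulrA; congr (_ * _).
by rewrite /quad_elt /= !fmorph_div -/N; field.
Qed.

Variables (chi : E -> algC) (chi' : E' -> algC) (c : E).
Hypotheses (chiP : addchar chi) (c_neq0 : c != 0).
Hypothesis chi'E : forall u v, chi' (quad_elt (u, v)) = chi (u + u).

(** [chi' (x + c / x)] for an [x] with trace [2 u] and norm [p], which is also
    [chi (x + c / x + y + c / y)] for [x], [y] in [E] with sum [2 u] and product
    [p]. *)
Let g (u p : E) := chi (u + c * u / p + (u + c * u / p)).

Lemma kloosterman_quad_sum : kloosterman chi' (iota c) =
  \sum_u \sum_(p | p != 0) g u p *+ #|[set v | e * v ^+ 2 == u ^+ 2 - p]|.
Proof.
rewrite /kloosterman (reindex quad_elt) /=; last exact: onW_bij quad_elt_bij.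
transitivity (\sum_(uv | uv.1 ^+ 2 - e * uv.2 ^+ 2 != 0)
    g uv.1 (uv.1 ^+ 2 - e * uv.2 ^+ 2)).
  apply: eq_big => [[u v]|[u v] uv_neq0].
    rewrite quad_norm_eq0 /=; congr (~~ _).
    rewrite -(inj_eq (bij_inj quad_elt_bij)); congr (_ == _).
    by rewrite /quad_elt /= !rmorph0 mul0r addr0.
  have uv0 : (u, v) != (0, 0).
    by apply: contraNneq uv_neq0 => ->; rewrite /quad_elt /= !rmorph0 mul0r addr0.
  rewrite quad_elt_inv //= /g; set N := u ^+ 2 - _; rewrite -(chi'E _ (v - c * v / N)).
  congr chi'; rewrite /quad_elt /= rmorphD rmorphB -!mulrA mulNr.
  by rewrite !(rmorphM, rmorphN) /=; ring.
rewrite -(pair_big_dep xpredT (fun u v => u ^+ 2 - e * v ^+ 2 != 0)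
  (fun u v => g u (u ^+ 2 - e * v ^+ 2))) /=; apply: eq_bigr => u _.
rewrite (sum_by_value (fun v => u ^+ 2 - e * v ^+ 2) (g u) (fun p => p != 0)).
apply: eq_bigr => p _.
congr (_ *+ _); apply: eq_card => v; rewrite !inE.
by rewrite subr_eq addrC -subr_eq eq_sym.
Qed.

Lemma kloosterman_sqr_sum : kloosterman chi c ^+ 2 =
  \sum_u \sum_(p | p != 0) g u p *+ #|[set w : E | w ^+ 2 == u ^+ 2 - p]|.
Proof.
have two_neq0 := odd_card_natr2_neq0 E_odd.
rewrite expr2 /kloosterman big_distrlr /= pair_big_dep /=.
pose rot (uw : E * E) := (uw.1 + uw.2, uw.1 - uw.2).
have rot_bij : bijective rot.
  apply: injF_bij => -[u w] [u' w'] [uw1 uw2].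
  have uE : u = u'.
    apply: (mulIf two_neq0); have -> : u * 2 = (u + w) + (u - w) by ring.
    by move: uw1 uw2 => /= -> ->; ring.
  by congr (_, _) => //; move: uw1; rewrite /= uE => /addrI.
rewrite (reindex rot) /=; last exact: onW_bij.
transitivity (\sum_(uw | uw.1 ^+ 2 - uw.2 ^+ 2 != 0) g uw.1 (uw.1 ^+ 2 - uw.2 ^+ 2)).
  apply: eq_big => [[u w]|[u w]] /=; first by rewrite subr_sqr mulf_eq0 negb_or andbC.
  case/andP=> uw1 uw2; rewrite -addcharD // /g; congr chi; field.
  by rewrite ?subr_sqr ?mulf_eq0 ?negb_or uw1 uw2.
rewrite -(pair_big_dep xpredT (fun u w => u ^+ 2 - w ^+ 2 != 0)
  (fun u w => g u (u ^+ 2 - w ^+ 2))) /=; apply: eq_bigr => u _.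
rewrite (sum_by_value (fun w => u ^+ 2 - w ^+ 2) (g u) (fun p => p != 0)).
apply: eq_bigr => p _.
congr (_ *+ _); apply: eq_card => w; rewrite !inE.
by rewrite subr_eq addrC -subr_eq eq_sym.
Qed.

(** The elements of [E'] with trace [2 u] and norm [p] correspond to the [v] with
    [e v^2 = u^2 - p], and the pairs in [E] with sum [2 u] and product [p] to the
    [w] with [w^2 = u^2 - p]. By [card_sqrt_nonsquare] the two kinds number 2
    together, so [K_E' + K_E^2] is twice the sum of [g], in which the sum over [u]
    kills every [p] but [p = - c]. *)
Lemma kloosterman_quadratic :
  kloosterman chi' (iota c) = #|E|%:R *+ 2 - kloosterman chi c ^+ 2.
Proof.
apply/eqP; rewrite eq_sym subr_eq eq_sym.
rewrite kloosterman_quad_sum kloosterman_sqr_sum -big_split /=.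
under eq_bigr => u _.
  rewrite -big_split /=; under eq_bigr => p _.
    rewrite -mulrnDr addnC card_sqrt_nonsquare //; over.
  over.
rewrite exchange_big /= (bigD1 (- c)) /= ?oppr_eq0 //.
rewrite [X in _ + X]big1 => [|p /andP[p_neq0 pc]].
  rewrite addr0 sumrMnl; apply/eqP; congr (_ *+ _).
  rewrite -sum1_card natr_sum; apply: eq_bigr => u _.
  rewrite /g (_ : c * u / - c = - u) ?addrN ?addr0 ?addchar0 //.
  by rewrite invrN mulrN mulrAC divff // mul1r.
rewrite sumrMnl; have -> : \sum_u g u p = \sum_u chi ((1 + c / p) *+ 2 * u).
  by apply: eq_bigr => u _; congr chi; rewrite mulr2n; ring.
rewrite sum_addcharM // (_ : _ == 0 = false) ?mul0r ?mul0rn //.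
rewrite mulr2n addff_eq0 //; apply: contraNF pc => /eqP.
rewrite addrC => /eqP; rewrite addr_eq0 => /eqP cp.
by rewrite -[c](divfK p_neq0) cp mulN1r opprK.
Qed.

End QuadraticStep.

(** * Characters that come from the base field *)

(** The properties of the trace from [E] down to [F] that matter below. They are
    stated abstractly, so that a form for a tower of quadratic extensions can be
    built one step at a time. *)
Definition trace_form (F E : finFieldType) (iota : F -> E) (T : E -> F) :=
  [/\ {morph T : x y / x + y}, forall s x, T (iota s * x) = s * T x,
      forall x, T (x ^+ #|F|) = T x & exists x, T x != 0].

Lemma trace_form_addchar (F E : finFieldType) (iota : {rmorphism F -> E}) T psi s :
  addchar psi -> trace_form iota T -> s != 0 -> addchar (fun x => psi (s * T x)).
Proof.
move=> psiP [TD TZ _ [x0 Tx0]] s_neq0; have [psi0 psiD [y psiy]] := psiP; split.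
- have -> : T 0 = 0 by apply: (addrI (T 0)); rewrite -TD !addr0.
  by rewrite mulr0.
- by move=> x1 x2; rewrite TD mulrDr psiD.
- exists (iota (s^-1 * (y / T x0)) * x0).
  by rewrite TZ -[s^-1 * _ * _]mulrA mulVKf // divfK.
Qed.

(** In terms of [x = u + v z] with [z^2 = e], the relative trace is [2 u], so the
    new form is [T (2 u)]. It is Frobenius invariant because [z^q] is [z] times an
    element of [E]. *)
Lemma trace_form_quadratic (F E : finFieldType) (iota : {rmorphism F -> E}) T psi :
  odd #|F| -> odd #|E| -> trace_form iota T -> addchar psi ->
  exists (E' : finFieldType) (iota' : {rmorphism F -> E'}) (T' : E' -> F),
    [/\ trace_form iota' T', (#|E'| = #|E| ^ 2)%N &
      forall s c, s != 0 -> c != 0 ->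
      kloosterman (fun x => psi (s * T' x)) (iota' c)
        = #|E|%:R *+ 2 - kloosterman (fun x => psi (s * T x)) (iota c) ^+ 2].
Proof.
move=> F_odd E_odd TP psiP; have [TD TZ TF [x0 Tx0]] := TP.
have [e e_nsq] := nonsquare_exists E_odd.
have [E' [kappa [z [z_sq E'_card]]]] := quadratic_extension e_nsq.
have [inv quadK invK] := quad_elt_bij e_nsq z_sq E'_card.
pose iota' : {rmorphism F -> E'} := kappa \o iota.
pose T' x := T ((inv x).1 + (inv x).1).
have T'E u v : T' (quad_elt kappa z (u, v)) = T (u + u) by rewrite /T' quadK.
have quadP x : exists u v, x = quad_elt kappa z (u, v).
  by exists (inv x).1, (inv x).2; rewrite -surjective_pairing invK.
exists E', iota', T'; split=> //.
- split.
  + move=> x y; have [u [v ->]] := quadP x; have [u' [v' ->]] := quadP y.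
    have -> : quad_elt kappa z (u, v) + quad_elt kappa z (u', v')
            = quad_elt kappa z (u + u', v + v').
      by rewrite /quad_elt /= !rmorphD; ring.
    by rewrite !T'E -TD; congr T; ring.
  + move=> s x; have [u [v ->]] := quadP x.
    have -> : iota' s * quad_elt kappa z (u, v) = quad_elt kappa z (iota s * u, iota s * v).
      by rewrite /quad_elt /= !rmorphM; ring.
    by rewrite !T'E -TZ mulrDr.
  + move=> x; have [u [v ->]] := quadP x.
    have q_pchar (K : finFieldType) (j : {rmorphism F -> K}) : [pchar K].-nat #|F|.
      by rewrite (eq_pnat _ (fmorph_pchar j)) finField_pchar_nat.
    have -> : quad_elt kappa z (u, v) ^+ #|F|
            = quad_elt kappa z (u ^+ #|F|, v ^+ #|F| * e ^+ #|F|./2).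
      rewrite /quad_elt /= exprDn_pchar ?(q_pchar _ iota') // exprMn.
      rewrite rmorphM !rmorphXn -z_sq -exprM; congr (_ + _); rewrite -mulrA; congr (_ * _).
      by rewrite -exprSr mul2n -[in LHS](odd_double_half #|F|) F_odd.
    by rewrite !T'E !TD !TF.
  + exists (quad_elt kappa z (x0, 0)).
    by rewrite T'E TD addff_eq0.
- move=> s c s_neq0 c_neq0.
  apply: (kloosterman_quadratic (z := z) (e := e)) => //=.
  + exact: trace_form_addchar TP s_neq0.
  + by rewrite fmorph_eq0.
  + by move=> u v; rewrite T'E.
Qed.

Section PointCount.
Variables (F E : finFieldType) (iota : {rmorphism F -> E}) (T : E -> F).
Hypotheses (TP : trace_form iota T).
Let q := #|F|.

Lemma trace_form_sub x y : T (x - y) = T x - T y.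
Proof.
have [TD _ _ _] := TP.
by apply/eqP; rewrite eq_sym subr_eq -TD subrK.
Qed.

Lemma card_trace_ker : (#|[set x | T x == 0%R]| * q = #|E|)%N.
Proof.
have [TD TZ TF [x0 Tx0]] := TP.
rewrite -(card_fibers T) mulnC -sum_nat_const; apply: eq_bigr => r _.
pose y := iota (r / T x0) * x0; have Ty : T y = r by rewrite TZ divfK.
rewrite -(card_imset _ (addIr y)); apply: eq_card => x.
apply/imsetP/idP => [[w]|]; rewrite inE => /eqP Tw.
  by move=> ->; rewrite inE TD Tw Ty add0r.
by exists (x - y); rewrite ?subrK // inE trace_form_sub Tw Ty subrr.
Qed.

(** Additive form of Hilbert's Theorem 90, by counting: each fibre of [z^q - z] has
    at most [q] elements, the fibres lie over the kernel of [T], and this kernel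
    has just [#|E| / q] elements. *)
Lemma card_artin_schreier t : T t = 0 -> #|[set z : E | z ^+ q - z == t]| = q.
Proof.
have [TD TZ TF _] := TP.
move=> Tt; apply: (@sum_nat_saturated _ [pred t | T t == 0]
   (fun t => #|[set z : E | (z ^+ q - z == t)%R]|)); last by rewrite inE Tt.
  move=> {Tt}t _; pose p : {poly E} := 'X^q - 'X - t%:P.
  have q_gt1 : (1 < q)%N by exact: finNzRing_gt1.
  have sz_p : size p = q.+1.
    rewrite /p -addrA size_polyDl size_polyXn //.
    rewrite -opprD size_polyN ltnS (leq_trans (size_polyD _ _)) // geq_max size_polyX q_gt1.
    by rewrite (leq_trans (size_polyC_leq1 _)) // ltnW.
  have p_neq0 : p != 0 by rewrite -size_poly_eq0 sz_p.
  have := max_poly_roots p_neq0 _ (enum_uniq [set z : E | z ^+ q - z == t]).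
  rewrite sz_p -cardE ltnS; apply; apply/allP => z.
  by rewrite mem_enum inE rootE !hornerE subr_eq0.
have -> : #|[pred t | T t == 0]| = #|[set x | T x == 0]| by rewrite cardsE.
rewrite card_trace_ker -(card_fibers (fun z : E => z ^+ q - z)) [X in (_ <= X)%N]big_mkcond.
apply: leq_sum => t' _; rewrite inE; case: ifP => // /negP Tt'.
rewrite (_ : [set _ | _] = set0) ?cards0 //; apply/setP => z; rewrite !inE.
by apply/eqP => zt; apply: Tt'; rewrite -zt trace_form_sub TF subrr.
Qed.

(** Summing over [s] retains the [x] with [T (x + c / x) = 0], each with weight [q],
    and by [card_artin_schreier] [q] is the number of ways to write [x + c / x] as
    [z^q - z]. *)
Lemma sum_kloosterman psi c : addchar psi ->
  \sum_s kloosterman (fun x => psi (s * T x)) c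
    = (\sum_z #|[set x : E | ((x != 0) && (x + c / x == z ^+ q - z))%R]|)%:R.
Proof.
move=> psiP; rewrite exchange_big /=.
rewrite (card_sigma_sum (fun (z x : E) => ((x != 0) && (x + c / x == z ^+ q - z))%R)).
rewrite natr_sum [RHS](bigID (fun x => x != 0)) /= [X in _ = _ + X]big1 ?addr0.
  apply: eq_bigr => x x_neq0.
  under eq_bigr do rewrite mulrC; rewrite sum_addcharM //.
  case: eqVneq => [Tx|Tx].
    rewrite mul1r -/q -[in LHS](card_artin_schreier Tx); congr (_%:R).
    by apply: eq_card => z; rewrite !inE x_neq0 eq_sym.
  rewrite mul0r (_ : [set _ | _] = set0) ?cards0 //; apply/setP => z; rewrite !inE x_neq0.
  apply/eqP => xz; have [_ _ TF _] := TP.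
  by move: Tx; rewrite xz trace_form_sub TF subrr eqxx.
move=> x /negPn /eqP ->; rewrite (_ : [set _ | _] = set0) ?cards0 //.
by apply/setP => z; rewrite !inE eqxx.
Qed.

End PointCount.

Section DiscriminantCount.
Variables (F E : finFieldType) (iota : {rmorphism F -> E}).
Hypotheses (E_odd : odd #|E|).
Let q := #|F|.
Variable c : E.
Hypothesis c_neq0 : c != 0.

(** The discriminant of [x^2 - (z^q - z) x + c], the equation for [x] in
    [x + c / x = z^q - z]. *)
Definition disc_poly : {poly E} := ('X^q - 'X) ^+ 2 - (4 * c)%:P.

Lemma horner_disc_poly z : disc_poly.[z] = (z ^+ q - z) ^+ 2 - 4 * c.
Proof. by rewrite /disc_poly !hornerE. Qed.

Let q_gt1 : (1 < q)%N. Proof. exact: finNzRing_gt1. Qed.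

Let four_neq0 : 4 * c != 0.
Proof.
have -> : 4 * c = 2 * (2 * c) by ring.
by rewrite !mulf_neq0 ?odd_card_natr2_neq0.
Qed.

Lemma size_disc_poly : size disc_poly = q.*2.+1.
Proof.
have szw : size ('X^q - 'X : {poly E}) = q.+1.
  by rewrite size_polyDl ?size_polyXn // size_polyN size_polyX ltnS.
have szw2 : size (('X^q - 'X : {poly E}) ^+ 2) = q.*2.+1.
  rewrite -[LHS]prednK ?size_exp ?szw ?muln2 //.
  by rewrite lt0n size_poly_eq0 expf_neq0 // -size_poly_eq0 szw.
rewrite /disc_poly size_polyDl ?szw2 // size_polyN.
by rewrite ltnS (leq_trans (size_polyC_leq1 _)) // double_gt0 ltnW.
Qed.

(** With [w = X^q - X] the derivative of [w^2 - 4c] is [- 2 w], since [q = 0] in [E];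
    so [(w^2 - 4c) + (w / 2) (- 2 w) = - 4c] is a Bezout identity. *)
Lemma separable_disc_poly : separable_poly disc_poly.
Proof.
have q0 : q%:R = 0 :> E.
  have [p p_pr pcharFp] := finPcharP F; rewrite -(rmorph_nat iota).
  have /= := card_pprimeChar pcharFp; rewrite -/q => qE.
  have q_dvd : (p %| q)%N.
    rewrite qE; move: (logn _ _) qE => [|k] qE; last by rewrite expnS dvdn_mulr.
    by move: q_gt1; rewrite qE.
  by apply/eqP; rewrite fmorph_eq0 -(dvdn_pcharf pcharFp).
rewrite unlock; apply/Bezout_eq1_coprimepP.
pose w : {poly E} := 'X^q - 'X.
have dw : w^`() = - 1.
  by rewrite /w derivB derivXn derivX -mulr_natr -polyC_natr q0 mulr0 sub0r.
exists ((- (4 * c)^-1)%:P, (- (4 * c)^-1)%:P * (2^-1)%:P * w) => /=.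
rewrite /disc_poly -/w derivB derivC subr0 expr2 derivM dw.
have four1 : ((4 * c)^-1)%:P * (4 * c)%:P = 1 :> {poly E} by rewrite -polyCM mulVf.
have two1 : (2^-1)%:P * 2 = 1 :> {poly E}.
  by rewrite -polyC_natr -polyCM mulVf // odd_card_natr2_neq0.
rewrite polyCN -[RHS]four1.
transitivity (((4 * c)^-1)%:P * (4 * c)%:P
   - ((4 * c)^-1)%:P * w * w * (1 - (2^-1)%:P * 2)); first by ring.
by rewrite two1 subrr mulr0 subr0.
Qed.

(** Solve the quadratic equation: [x = (y + t) / 2]. *)
Lemma card_shifted_sqrt_le t :
  (#|[set y | y ^+ 2 == (t ^+ 2 - 4 * c)%R]|
     <= #|[set x | ((x != 0) && (x + c / x == t))%R]|)%N.
Proof.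
have two_neq0 := odd_card_natr2_neq0 E_odd.
have f_inj : injective (fun y => (y + t) / 2).
  by move=> y1 y2 /(mulIf (invr_neq0 two_neq0))/addIr.
rewrite -(card_imset _ f_inj) subset_leq_card //; apply/subsetP => x /imsetP[y].
rewrite !inE => /eqP yE ->; have xt : (y + t) * (t - y) = 4 * c.
  have -> : (y + t) * (t - y) = t ^+ 2 - y ^+ 2 by ring.
  by rewrite yE; ring.
have yt_neq0 : y + t != 0.
  by apply: contraNneq four_neq0 => yt0; rewrite -xt yt0 mul0r.
rewrite mulf_neq0 ?invr_neq0 //=; apply/eqP.
have nat4_neq0 : 4 != 0 :> E by rewrite (natrM _ 2 2) mulf_neq0.
have -> : c = (y + t) * (t - y) / 4 by rewrite xt mulrAC mulfV ?mul1r.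
by field; rewrite two_neq0 yt_neq0.
Qed.

(** Each [z] gives two points [y], unless the value at [z] vanishes, which happens
    at most [2 q] times, or is not a square, which happens at most
    [n^2 / 2 + 3 q n] times by [stepanov_bound] with [mu = q]. *)
Lemma sum_card_sqrt_ge n : [pchar E].-nat n -> #|E| = (n ^ 2)%N -> (4 * q <= n)%N ->
  (n ^ 2 <= \sum_(z : E) #|[set y | y ^+ 2 == disc_poly.[z]]| + 10 * q * n)%N.
Proof.
move=> n_pchar E_card q_le.
have n_odd : odd n by move: E_odd; rewrite E_card oddX.
have f0 : disc_poly.[0] != 0.
  rewrite horner_disc_poly subr0 -exprM expr0n muln_eq0 gtn_eqF ?(ltnW q_gt1) //.
  by rewrite sub0r oppr_eq0.
have := stepanov_bound n_pchar n_odd E_card f0 separable_disc_poly size_disc_poly _ q_le.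
move/(_ (ltnW q_gt1)); set S := [set _ | _] => S_le.
have Z_le : (#|[set z : E | disc_poly.[z] == 0%R]| <= q.*2)%N.
  have p_neq0 : disc_poly != 0 by rewrite -size_poly_eq0 size_disc_poly.
  have := max_poly_roots p_neq0 _ (enum_uniq [set z : E | disc_poly.[z] == 0]).
  rewrite size_disc_poly -cardE ltnS; apply; apply/allP => z.
  by rewrite mem_enum inE.
have : (\sum_(z : E) 2 <= \sum_(z : E) (#|[set y : E | y ^+ 2 == disc_poly.[z]]|
   + (2 * (z \in S) + 2 * (disc_poly.[z] == 0%R))))%N.
  apply: leq_sum => z _; have [fz|fz] := eqVneq disc_poly.[z] 0.
    by rewrite muln1 addnA leq_addl.
  have [y0|[y]] := set_0Vmem [set y : E | y ^+ 2 == disc_poly.[z]].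
    have z_nsq w : w ^+ 2 != disc_poly.[z].
      by move/setP/(_ w): y0; rewrite !inE => ->.
    have -> : z \in S by rewrite inE -E_card; apply/eqP; apply: nonsquare_euler.
    by rewrite muln1 addnA addnAC leq_addl.
  rewrite inE => /eqP yE; rewrite -yE card_sqrt_sqr ?leq_addr //.
  by apply: contraNneq fz => y0; rewrite -yE y0 expr0n.
have dist2 (f : E -> nat) : (\sum_z 2 * f z = 2 * \sum_z f z)%N by rewrite big_distrr.
rewrite 2!big_split /= (dist2 (fun z => z \in S)) (dist2 (fun z => disc_poly.[z] == 0)).
rewrite sum_nat_const.
have -> : (\sum_(z : E) (z \in S) = #|S|)%N.
  by rewrite -sum1_card [RHS]big_mkcond; apply: eq_bigr => z; case: (z \in S).
have -> : (\sum_(z : E) (disc_poly.[z] == 0%R) = #|[set z : E | disc_poly.[z] == 0%R]|)%N.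
  by rewrite -sum1dep_card [RHS]big_mkcond; apply: eq_bigr => z; case: eqP.
rewrite E_card; move: S_le Z_le q_le; move: #|S| #|[set z : E | _]| (\sum_z _)%N => a b s.
nia.
Qed.

End DiscriminantCount.

(** * Weil's bound for Kloosterman sums *)
Lemma trace_form_id (F : finFieldType) : trace_form (@idfun F) id.
Proof.
by split=> //; [move=> x; rewrite expf_card | exists 1; rewrite oner_eq0].
Qed.

(** Since [(2 + e)^2 - 2 = 2 + 4 e + e^2], an excess over 2 at least doubles. *)
Lemma kloosterman_growth (n K e : algC) : 0 <= n -> K \is Num.real -> 0 <= e ->
  (2 + e) * n <= - K -> (2 + 2 * e) * n ^+ 2 <= - (n ^+ 2 *+ 2 - K ^+ 2).
Proof.
move=> n_ge0 K_real e_ge0 K_ge.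
have K2_ge : ((2 + e) * n) ^+ 2 <= K ^+ 2.
  rewrite -[K ^+ 2]sqrrN ler_pXn2r ?nnegrE //.
    by rewrite mulr_ge0 // addr_ge0.
  by rewrite (le_trans _ K_ge) // mulr_ge0 // addr_ge0.
rewrite opprB lerBrDr (le_trans _ K2_ge) // -subr_ge0.
have -> : ((2 + e) * n) ^+ 2 - ((2 + 2 * e) * n ^+ 2 + n ^+ 2 *+ 2)
        = (e * 2 + e ^+ 2) * n ^+ 2.
  by rewrite -mulr_natl; ring.
by rewrite mulr_ge0 ?exprn_ge0 // addr_ge0 ?mulr_ge0 // exprn_ge0.
Qed.

(** Iterating [kloosterman_quadratic]: the lower bound [- 2 n] holds for every [s]
    because [K^2 >= 0] one level below, and an initial excess [e] over the bound
    of Weil is amplified by [kloosterman_growth]. *)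
Lemma kloosterman_tower (F : finFieldType) (psi : F -> algC) (c : F) k :
  odd #|F| -> addchar psi -> c != 0 ->
  exists (E : finFieldType) (iota : {rmorphism F -> E}) (T : E -> F),
    let n := (#|F| ^ (2 ^ k))%N in
    [/\ trace_form iota T, #|E| = (n ^ 2)%N
      & forall s, s != 0 ->
        let K0 := kloosterman (fun x => psi (s * x)) c in
        let K := kloosterman (fun x => psi (s * T x)) (iota c) in
        - (2 * n%:R) <= - K /\
        forall e, 0 <= e -> (4 + e) * #|F|%:R <= K0 ^+ 2 ->
          (2 + (2 ^ k)%:R * e) * n%:R <= - K].
Proof.
move=> F_odd psiP c_neq0.
have kl_real (E : finFieldType) (iota : {rmorphism F -> E}) T s :
    trace_form iota T -> s != 0 ->
    kloosterman (fun x => psi (s * T x)) (iota c) \is Num.real.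
  by move=> TP s_neq0; apply: kloosterman_real; apply: trace_form_addchar TP s_neq0.
elim: k => [|k [E [iota [T [TP E_card IH]]]]].
  have [E [iota [T [TP E_card KE]]]] :=
    trace_form_quadratic F_odd F_odd (trace_form_id F) psiP.
  exists E, iota, T; rewrite expn0 expn1; split=> // s s_neq0.
  have K0_real := kl_real _ _ _ s (trace_form_id F) s_neq0.
  rewrite (KE s c) //= opprB; split.
    by rewrite lerBrDr mulr_natl addNr real_exprn_even_ge0.
  move=> e e_ge0; rewrite mul1r lerBrDr -[#|F|%:R *+ 2]mulr_natl; apply: le_trans.
  by rewrite -mulrDl addrAC (_ : 2 + 2 = 4) // -natrD.
have E_odd : odd #|E| by rewrite E_card !oddX F_odd !orbT.
have [E' [iota' [T' [TP' E'_card KE]]]] := trace_form_quadratic F_odd E_odd TP psiP.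
exists E', iota', T'.
have nE : (#|F| ^ (2 ^ k.+1) = (#|F| ^ (2 ^ k)) ^ 2)%N by rewrite expnS -expnM mulnC.
split=> //; first by rewrite nE E'_card E_card.
move=> s s_neq0; have [_ IHs] := IH s s_neq0.
have K_real := kl_real _ _ _ s TP s_neq0.
rewrite (KE s c) // nE E_card natrX; split.
  by rewrite opprB lerBrDr mulr_natl addNr real_exprn_even_ge0.
move=> e e_ge0 /(IHs e e_ge0) /kloosterman_growth.
rewrite expnS natrM -mulrA; apply => //.
by rewrite mulr_ge0.
Qed.

(** The sum over all [s] of the Kloosterman sums over [E] is at least
    [n^2 - 10 q n], and [s = 0] contributes [n^2 - 1]. As each of the others is at
    most [2 n], the one for [s = 1] cannot be below [- 12 q n]; but a violation of
    the bound would make it arbitrarily negative compared with [n]. *)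
Lemma kloosterman_bound (F : finFieldType) (psi : F -> algC) (c : F) :
  odd #|F| -> addchar psi -> c != 0 -> kloosterman psi c ^+ 2 <= 4 * #|F|%:R.
Proof.
move=> F_odd psiP c_neq0; set q := #|F|.
have K_real := kloosterman_real c psiP; set K0 := kloosterman psi c in K_real *.
have q_gt1 : (1 < q)%N by exact: finNzRing_gt1.
have q_gt0 : 0 < q%:R :> algC by rewrite ltr0n ltnW.
rewrite real_leNgt ?rpredM ?rpredX ?realn //; apply/negP => K_gt.
pose e := K0 ^+ 2 / q%:R - 4.
have e_gt0 : 0 < e by rewrite subr_gt0 ltr_pdivlMr.
have K0E : (4 + e) * q%:R <= K0 ^+ 2.
  by rewrite /e addrC subrK divfK // gt_eqF.
have B_ge0 : 0 <= 12 * q%:R / e by rewrite divr_ge0 ?mulr_ge0 // ltW.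
(* The height [k >= 2] guarantees [4 q <= n], as point counting requires. *)
have [k k_ge2 k_gt] : exists2 k, (2 <= k)%N & 12 * q%:R / e < (2 ^ k)%:R.
  exists (Num.bound (12 * q%:R / e)).+2 => //.
  rewrite (lt_trans (archi_boundP B_ge0)) // ltr_nat.
  by rewrite (ltn_trans (ltn_expl _ (ltnSn 1))) // ltn_exp2l.
have [E [iota [T []]]] := kloosterman_tower k F_odd psiP c_neq0.
have [n nE] : exists n, n = (q ^ (2 ^ k))%N by exists (q ^ (2 ^ k))%N.
rewrite -/q -nE => TP E_card KE.
have E_odd : odd #|E| by rewrite E_card nE !oddX F_odd !orbT.
have n_pchar : [pchar E].-nat n.
  by have := finField_pchar_nat E; rewrite E_card pnatX => /orP[].
have n_ge : (4 * q <= n)%N.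
  rewrite nE; apply: (@leq_trans (q ^ 4)).
    have q_ge3 : (3 <= q)%N.
      by rewrite ltn_neqAle q_gt1 andbT; apply: contraTneq F_odd; rewrite -/q => <-.
    rewrite expnSr leq_mul2r; apply/orP; right.
    by apply: (@leq_trans (3 ^ 3)); rewrite ?leq_exp2r.
  by rewrite leq_exp2l // (@leq_exp2l 2 2).
have n_pos : (0 < n)%N by rewrite nE expn_gt0 ltnW.
have n_gt0 : 0 < n%:R :> algC by rewrite ltr0n.
have /(KE 1)[_ /(_ e (ltW e_gt0))] := oner_neq0 F.
have -> : kloosterman (fun x => psi (1 * x)) c = K0.
  by apply: eq_bigr => x _; rewrite mul1r.
move=> /(_ K0E); set K1 := kloosterman _ _ => K1_ge.
have := sum_card_sqrt_ge iota E_odd (_ : iota c != 0) n_pchar E_card n_ge.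
rewrite fmorph_eq0 -/q => /(_ c_neq0) n_le.
have {}n_le : (n ^ 2 <= \sum_(z : E)
   #|[set x : E | ((x != 0) && (x + iota c / x == z ^+ q - z))%R]| + 10 * q * n)%N.
  apply: leq_trans n_le _; rewrite leq_add2r; apply: leq_sum => z _.
  rewrite horner_disc_poly; apply: card_shifted_sqrt_le => //.
  by rewrite fmorph_eq0.
move: n_le; rewrite -(ler_nat algC) natrD -(sum_kloosterman TP (psi := psi)) //.
rewrite (bigD1 0) //= (bigD1 1) ?oner_eq0 //=.
have -> : kloosterman (fun x => psi (0 * T x)) (iota c) = (n ^ 2)%:R - 1.
  rewrite /kloosterman; under eq_bigr do rewrite mul0r (addchar0 psiP).
  rewrite sumr_const; have -> : #|[pred x : E | x != 0]| = (n ^ 2).-1.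
    by rewrite -E_card -(cardsC1 (0 : E)); apply: eq_card => x; rewrite !inE.
  by rewrite -subn1 natrB // expn_gt0 n_pos.
set r := \sum_(s | _) _; have r_le : r <= (2 * q * n)%:R.
  apply: le_trans (_ : \sum_(s : F | (s != 0) && (s != 1)) 2 * n%:R <= _).
    by apply: ler_sum => s /andP[s_neq0 _]; have [] := KE s s_neq0; rewrite lerN2.
  rewrite sumr_const -natrM -mulrnA ler_nat mulnAC.
  by rewrite leq_mul2r leq_mul2l max_card !orbT.
rewrite -/K1 => n_le.
have K1_le : - K1 <= (12 * q * n)%:R.
  have -> : (12 * q * n = 2 * q * n + 10 * q * n)%N by rewrite -!mulnDl.
  rewrite natrD; apply: le_trans (lerD r_le (lexx _)).
  rewrite -subr_ge0; apply: le_trans ler01 _; rewrite -subr_ge0.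
  move: n_le; rewrite -subr_ge0 => n_le; apply: etrans n_le; congr (0 <= _).
  ring.
move: (le_trans K1_ge K1_le); rewrite natrM ler_pM2r // natrM => e_le.
rewrite ltr_pdivrMr // in k_gt.
have : 12 * q%:R < 12 * q%:R :> algC.
  by rewrite (lt_le_trans k_gt) // (le_trans _ e_le) // lerDr.
by rewrite ltxx.
Qed.

(** * Gauss sums and the Fourier coefficients of spheres *)
Section GaussSum.
Variables (F : finFieldType) (psi : F -> algC).
Hypotheses (F_odd : odd #|F|) (psiP : addchar psi).
Let q := #|F|.

Definition gauss (u : F) : algC := \sum_x psi (u * x ^+ 2).

Let two_neq0 : 2 != 0 :> F := odd_card_natr2_neq0 F_odd.

Let four_neq0 : 4 != 0 :> F.
Proof. by rewrite (natrM _ 2 2) mulf_neq0. Qed.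

Lemma gauss_norm u : u != 0 -> `|gauss u| ^+ 2 = q%:R.
Proof.
move=> u_neq0; rewrite normCK /gauss rmorph_sum mulr_sumr /=.
under eq_bigr => y _.
  rewrite mulr_suml (reindex_inj (addIr y)).
  under eq_bigr => w _.
    rewrite addchar_conj // -addcharD //.
    rewrite (_ : _ + _ = u * w ^+ 2 + (2 * u * w) * y); last by ring.
    rewrite addcharD //; over.
  over.
rewrite exchange_big (bigD1 0) //= [X in _ + X]big1 => [|w w_neq0].
  by rewrite addr0 -mulr_sumr expr0n mulr0 addchar0 // sum_addcharM // mulr0 eqxx !mul1r.
rewrite -mulr_sumr sum_addcharM // !mulf_eq0.
by rewrite !(negPf w_neq0, negPf u_neq0, negPf two_neq0) mul0r mulr0.
Qed.

Lemma gauss_neq0 u : u != 0 -> gauss u != 0.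
Proof.
move=> u_neq0; rewrite -normr_eq0 -sqrf_eq0 gauss_norm // pnatr_eq0 -lt0n.
by rewrite ltnW ?finNzRing_gt1.
Qed.

(** If [v = w^2] then the substitution of [w x] for [x] shows that the sums agree.
    If [v] is not a square, then every value is taken twice by [x^2] and [v x^2]
    together, so the two sums add up to a complete character sum, which is 0. *)
Lemma gauss_scale v : v != 0 ->
  (forall u, gauss (u * v) = gauss u) \/ (forall u, u != 0 -> gauss (u * v) = - gauss u).
Proof.
move=> v_neq0; have [v0|[w]] := set_0Vmem [set w : F | w ^+ 2 == v];
  [|rewrite inE => /eqP wv]; [right | left] => u.
  move=> u_neq0; have v_nsq w : w ^+ 2 != v by move/setP/(_ w): v0; rewrite !inE => ->.
  apply/eqP; rewrite -addr_eq0 /gauss.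
  rewrite (eq_bigr (fun x => psi (u * (v * x ^+ 2)))) => [|x _]; last by rewrite mulrA.
  rewrite (sum_by_value (fun x => v * x ^+ 2) (fun a => psi (u * a)) predT).
  rewrite (sum_by_value (fun x => x ^+ 2) (fun a => psi (u * a)) predT).
  rewrite -big_split /=.
  under eq_bigr => a _ do rewrite -mulrnDr addnC card_sqrt_nonsquare //.
  by rewrite sumrMnl sum_addcharM // (negPf u_neq0) mul0r mul0rn.
have w_neq0 : w != 0.
  by apply: contraNneq v_neq0 => w0; rewrite -wv w0 expr0n.
rewrite /gauss [RHS](reindex_inj (mulfI w_neq0)); apply: eq_bigr => x _.
by rewrite -wv; congr psi; ring.
Qed.

Lemma gauss_sqr u : u != 0 -> gauss u ^+ 2 = gauss 1 ^+ 2.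
Proof.
move=> u_neq0; rewrite -[u]mul1r.
by have [->|->] := gauss_scale u_neq0; rewrite ?oner_neq0 // sqrrN.
Qed.

Lemma sum_addchar_inv a : a != 0 -> \sum_(y | y != 0) psi (a / y) = -1.
Proof.
move=> a_neq0; rewrite (reindex_inj invr_inj) /=.
rewrite (eq_big (fun y => y != 0) (fun y => psi (a * y))) => [|y|y _];
  rewrite ?invr_eq0 ?invrK //.
have := sum_addcharM psiP a; rewrite (negPf a_neq0) mul0r (bigD1 0) //= mulr0 addchar0 //.
by move/eqP; rewrite addrC addr_eq0 => /eqP.
Qed.

Lemma kloosterman_sum_bound (M c : F) : c != 0 ->
  `|\sum_(y | y != 0) psi (M * y + c / y)| ^+ 2 <= 4 * q%:R.
Proof.
move=> c_neq0; have [->|M_neq0] := eqVneq M 0.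
  under eq_bigr do rewrite mul0r add0r.
  rewrite sum_addchar_inv // normrN1 expr1n -natrM ler1n muln_gt0.
  by apply: ltnW; exact: finNzRing_gt1.
have chiP : addchar (fun x => psi (M * x)).
  exact: trace_form_addchar psiP (trace_form_id F) M_neq0.
have -> : \sum_(y | y != 0) psi (M * y + c / y)
        = kloosterman (fun x => psi (M * x)) (c / M).
  by apply: eq_bigr => y y_neq0; congr psi; field; rewrite ?y_neq0 ?M_neq0.
rewrite real_normK ?kloosterman_real //; apply: kloosterman_bound => //.
by rewrite mulf_neq0 ?invr_neq0.
Qed.

(** Rescaling [y] reduces to [c = -1]. Expanding the Gauss sum and shifting its
    variable [u] by [1 / y] turns the phase [y u^2 + M y - 1 / y] into
    [2 u + (u^2 + M) y]; the sum over [y] then leaves only the at most two [u]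
    with [u^2 = - M], each with weight [q]. *)
Lemma salie_bound (M c : F) : c != 0 ->
  `|\sum_(y | y != 0) gauss y * psi (M * y + c / y)| <= 2 * q%:R.
Proof.
move=> c_neq0; pose k := - c; have k_neq0 : k != 0 by rewrite oppr_eq0.
rewrite (reindex_inj (mulIf k_neq0)) /=.
have -> : `|\sum_(y | y * k != 0) gauss (y * k) * psi (M * (y * k) + c / (y * k))|
        = `|\sum_(y | y != 0) gauss y * psi (M * k * y - 1 / y)|.
  have argE y : y != 0 -> M * (y * k) + c / (y * k) = M * k * y - 1 / y.
    by move=> y_neq0; rewrite /k; field; rewrite y_neq0.
  have [gk|gk] := gauss_scale k_neq0; [congr Num.norm | rewrite -normrN; congr Num.norm].
    apply: eq_big => [y|y]; rewrite mulf_eq0 (negPf k_neq0) orbF // => y_neq0.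
    by rewrite gk argE.
  rewrite -sumrN; apply: eq_big => [y|y]; rewrite mulf_eq0 (negPf k_neq0) orbF // => y_neq0.
  by rewrite gk // argE // mulNr opprK.
have -> : \sum_(y | y != 0) gauss y * psi (M * k * y - 1 / y)
        = q%:R * \sum_(u | u ^+ 2 == - (M * k)) psi (2 * u).
  transitivity (\sum_(y | y != 0) \sum_u psi (2 * u) * psi ((u ^+ 2 + M * k) * y)).
    apply: eq_bigr => y y_neq0; rewrite /gauss (reindex_inj (addIr y^-1)) mulr_suml.
    apply: eq_bigr => u _; rewrite -!addcharD //; congr psi; field.
    exact: y_neq0.
  rewrite exchange_big mulr_sumr /= [RHS]big_mkcond.
  transitivity (\sum_u (psi (2 * u) * ((u ^+ 2 + M * k == 0)%:R * q%:R) - psi (2 * u))).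
    apply: eq_bigr => u _.
    rewrite -mulr_sumr -(sum_addcharM psiP) [X in _ = _ * X - _](bigD1 0) //=.
    by rewrite mulr0 addchar0 // mulrDr mulr1 [RHS]addrC addKr.
  rewrite sumrB sum_addcharM // (negPf two_neq0) mul0r subr0; apply: eq_bigr => u _.
  by rewrite -addr_eq0; case: eqP => _; rewrite ?mul1r ?mul0r ?mulr0 // mulrC.
rewrite normrM normr_nat mulrC ler_wpM2r //.
apply: le_trans (ler_norm_sum _ _ _) _.
under eq_bigr do rewrite addchar_norm //.
rewrite sumr_const ler_nat; have [e e_nsq] := nonsquare_exists F_odd.
by rewrite -[X in (_ <= X)%N](card_sqrt_nonsquare F_odd (- (M * k)) e_nsq) cardsE leq_addr.
Qed.

(** As [gauss y ^ 2] is the same for all [y != 0], the factor [gauss y ^ (- d)] is a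
    constant when [d] is even, and a constant times [gauss y] when [d] is odd. *)
Lemma radial_coef_bound d (M c : F) : c != 0 ->
  `|\sum_(y | y != 0) (gauss y ^+ d)^-1 * psi (M * y + c / y)| ^+ 2 * q%:R ^+ d <= 4 * q%:R.
Proof.
move=> c_neq0; have g1_norm := gauss_norm (oner_neq0 F).
have q_gt0 : 0 < q%:R :> algC by rewrite ltr0n ltnW ?finNzRing_gt1.
pose k := uphalf d; pose gam := (gauss 1 ^+ 2) ^+ k.
have gam_norm : `|gam| = q%:R ^+ k by rewrite /gam !normrX g1_norm.
have gE y : y != 0 -> (gauss y ^+ d)^-1 = gam^-1 * gauss y ^+ odd d.
  move=> y_neq0; have gy_neq0 := gauss_neq0 y_neq0.
  have gamE : gam = gauss y ^+ d * gauss y ^+ odd d.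
    rewrite /gam -(gauss_sqr y_neq0) -exprM -exprD mul2n /k uphalf_half.
    rewrite -[in RHS](odd_double_half d); congr (_ ^+ _); rewrite doubleD.
    by case: (odd d); lia.
  by rewrite gamE invfM divfK ?expf_neq0.
under eq_bigr => y y_neq0 do rewrite gE // -mulrA.
rewrite -mulr_sumr normrM exprMn normfV gam_norm.
rewrite mulrAC -exprVn -exprM.
have q_neq0 : q%:R != 0 :> algC by rewrite gt_eqF.
have -> : q%:R^-1 ^+ (k * 2) * q%:R ^+ d = q%:R^-1 ^+ odd d :> algC.
  have -> : (k * 2 = odd d + d)%N.
    by rewrite muln2 /k uphalf_half -[in RHS](odd_double_half d); case: (odd d); lia.
  by rewrite exprD -mulrA -exprMn mulVf // expr1n mulr1.
case: (odd d) => /=; last first.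
  by under eq_bigr do rewrite expr0 mul1r; rewrite mul1r kloosterman_sum_bound.
under eq_bigr do rewrite expr1.
rewrite mulrC ler_pdivrMr // -mulrA -expr2.
have -> : 4 * q%:R ^+ 2 = (2 * q%:R) ^+ 2 :> algC by ring.
have q2_ge0 : 0 <= 2 * q%:R :> algC by rewrite mulr_ge0 // ltW.
by rewrite ler_pXn2r ?nnegrE ?salie_bound.
Qed.

Definition dot d (m v : 'rV[F]_d) : F := \sum_i m 0 i * v 0 i.

Lemma dotBr d (m v w : 'rV[F]_d) : dot m (v - w) = dot m v - dot m w.
Proof. by rewrite -sumrB; apply: eq_bigr => i _; rewrite !mxE mulrBr. Qed.

(** The sum factors over the coordinates; complete the square in each of them. *)
Lemma gauss_rV d (v : 'rV[F]_d) y : y != 0 ->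
  \sum_m psi (dot m v + y * sqnorm m) = gauss y ^+ d * psi (- (sqnorm v / (4 * y))).
Proof.
move=> y_neq0.
have -> : \sum_m psi (dot m v + y * sqnorm m)
        = \prod_(i < d) \sum_t psi (t * v 0 i + y * t ^+ 2).
  rewrite bigA_distr_bigA /= (reindex (fun g : {ffun 'I_d -> F} => \row_i g i)) /=.
    apply: eq_bigr => g _; rewrite -addchar_sumr //; congr psi.
    rewrite /dot /sqnorm mulr_sumr -big_split; apply: eq_bigr => i _.
    by rewrite !mxE.
  apply: onW_bij; exists (fun m : 'rV[F]_d => [ffun i => m 0 i]) => [g|m].
    by apply/ffunP => i; rewrite ffunE mxE.
  by apply/rowP => i; rewrite mxE ffunE.
rewrite -[d in gauss y ^+ d]card_ord -prodr_const.
have -> : - (sqnorm v / (4 * y)) = \sum_i - (v 0 i ^+ 2 / (4 * y)).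
  by rewrite sumrN -mulr_suml.
rewrite addchar_sumr // -big_split /=; apply: eq_bigr => i _.
rewrite /gauss mulr_suml (reindex_inj (addIr (- (v 0 i / (2 * y))))) /=.
apply: eq_bigr => t _; rewrite -addcharD //; congr psi; field.
by rewrite two_neq0 y_neq0 four_neq0.
Qed.

(** The Fourier coefficient at [m] of [q] times the indicator of the sphere of
    radius [r], minus 1. *)
Definition sphere_coef d (r : F) (m : 'rV[F]_d) : algC :=
  \sum_(y | y != 0) (gauss y ^+ d)^-1 * psi (sqnorm m * y + r / 4 / y).

(** Detect [sqnorm v = r] by the sum over [s] of [psi (s (sqnorm v - r))], put
    [s = - 1 / 4y] for [s != 0], and expand [psi (- sqnorm v / 4y)] by
    [gauss_rV]. *)
Lemma sphere_fourier d (r : F) (v : 'rV[F]_d) :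
  (sqnorm v == r)%:R * q%:R = 1 + \sum_m sphere_coef r m * psi (dot m v).
Proof.
rewrite -subr_eq0 -(sum_addcharM psiP) (bigD1 0) //= mulr0 addchar0 //.
transitivity (1 + \sum_(s | s != 0) psi ((sqnorm v - r) * s)).
  by congr (_ + _); apply: eq_bigr => s _; rewrite mulrC.
congr (1 + _).
have inv_neq0 (y : F) : (- (4 * y)^-1 != 0) = (y != 0).
  by rewrite oppr_eq0 invr_eq0 mulf_eq0 (negPf four_neq0).
have inv_inj : injective (fun y : F => - (4 * y)^-1).
  by move=> x y /oppr_inj/invr_inj/(mulfI four_neq0).
rewrite (reindex_inj inv_inj) /= (eq_bigl _ _ inv_neq0).
under [RHS]eq_bigr do rewrite mulr_suml.
rewrite exchange_big /=; apply: eq_bigr => y y_neq0.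
under eq_bigr do rewrite -(mulrA _ (psi _) (psi _)) -(addcharD psiP).
have gy_neq0 : gauss y ^+ d != 0 by rewrite expf_neq0 ?gauss_neq0.
apply: (mulfI gy_neq0); rewrite mulr_sumr.
transitivity (\sum_m psi (dot m v + y * sqnorm m) * psi (r / 4 / y)).
  rewrite -mulr_suml gauss_rV // -mulrA -addcharD //; congr (_ * psi _); field.
  by rewrite y_neq0 four_neq0.
apply: eq_bigr => m _; rewrite mulVKf // -addcharD //; congr psi; ring.
Qed.

Lemma sum_dot_norm d (A : {set 'rV[F]_d}) :
  \sum_m `|\sum_(x in A) psi (dot m x)| ^+ 2 = q%:R ^+ d * #|A|%:R.
Proof.
under eq_bigr => m _.
  rewrite normCK rmorph_sum mulr_suml /=.
  under eq_bigr => x _.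
    rewrite mulr_sumr; under eq_bigr => y _.
      rewrite addchar_conj // -addcharD // -dotBr.
      rewrite (_ : dot m (x - y) = dot (x - y) m); last first.
        by apply: eq_bigr => i _; rewrite mulrC.
      over.
    over.
  over.
rewrite exchange_big mulrC -sum1_card natr_sum mulr_suml; apply: eq_bigr => x xA.
rewrite exchange_big (bigD1 x) //= [X in _ + X]big1 => [|y /andP[_ yx]].
  by rewrite /dot sum_addchar_dot // subrr eqxx addr0 !mul1r.
by rewrite /dot sum_addchar_dot // subr_eq0 eq_sym (negPf yx) mul0r.
Qed.

End GaussSum.

(** * Discrepancy of the distance graphs *)

(** Lagrange's identity. *)
Lemma cauchy_schwarz_sum (R : numDomainType) (I : finType) (a b : I -> R) :
  (forall i, a i \is Num.real) -> (forall i, b i \is Num.real) ->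
  (\sum_i a i * b i) ^+ 2 <= (\sum_i a i ^+ 2) * (\sum_i b i ^+ 2).
Proof.
move=> a_real b_real; rewrite -(ler_pM2l (ltr0Sn R 1)) -subr_ge0.
have -> : 2 * ((\sum_i a i ^+ 2) * (\sum_i b i ^+ 2)) - 2 * (\sum_i a i * b i) ^+ 2
        = \sum_i \sum_j (a i * b j - a j * b i) ^+ 2.
  have sqE i j : (a i * b j - a j * b i) ^+ 2
      = a i ^+ 2 * b j ^+ 2 + b i ^+ 2 * a j ^+ 2 - 2 * ((a i * b i) * (a j * b j)) by ring.
  under [RHS]eq_bigr do under eq_bigr do rewrite sqE.
  under [RHS]eq_bigr do rewrite sumrB big_split /= -!mulr_sumr.
  rewrite sumrB big_split /= -!mulr_suml -mulr_sumr -mulr_suml; ring.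
do 2 (apply: sumr_ge0 => ? _); rewrite real_exprn_even_ge0 //.
by rewrite rpredB ?rpredM.
Qed.

(** [q e - #|A| #|B|] is the sum over [m] of the sphere coefficient times the
    product of the transforms of [A] and [B]; the first is at most [l], with
    [l^2 = 4 q^(1 - d)], and Cauchy-Schwarz with Plancherel ([sum_dot_norm])
    bounds the rest by [q^d sqrt (#|A| #|B|)]. *)
Lemma distance_discrepancy (F : finFieldType) d (r : F) (A B : {set 'rV[F]_d}) :
  odd #|F| -> r != 0 ->
  (#|F|%:Z * (\sum_(x in A) #|[set y in B | sqnorm (x - y) == r]|)%N%:Z
     - (#|A| * #|B|)%N%:Z) ^+ 2 <= (4 * #|F| ^ d.+1 * (#|A| * #|B|))%N%:Z.
Proof.
move=> F_odd r_neq0; have [psi psiP] := addchar_exists F; set q := #|F|.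
have q_neq0 : q%:R != 0 :> algC.
  by rewrite pnatr_eq0 -lt0n ltnW ?finNzRing_gt1.
pose fA m := \sum_(x in A) psi (dot m x); pose fB m := \sum_(y in B) psi (dot m y).
set e := (\sum_(x in A) _)%N.
have eE : q%:R * e%:R - (#|A| * #|B|)%:R = \sum_m sphere_coef psi r m * (fA m * (fB m)^*).
  have -> : (#|A| * #|B|)%:R = \sum_(x in A) \sum_(y in B) (1 : algC).
    by rewrite !sumr_const -mulrnA mulnC.
  have -> : q%:R * e%:R
          = \sum_(x in A) \sum_(y in B) (sqnorm (x - y) == r)%:R * q%:R :> algC.
    rewrite mulrC /e natr_sum mulr_suml; apply: eq_bigr => x _.
    rewrite -mulr_suml -sum1dep_card natr_sum big_mkcondr; congr (_ * _).
    by apply: eq_bigr => y _; case: eqP.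
  rewrite -sumrB; under eq_bigr do rewrite -sumrB.
  transitivity (\sum_(x in A) \sum_(y in B)
                  \sum_m sphere_coef psi r m * psi (dot m (x - y))).
    apply: eq_bigr => x _; apply: eq_bigr => y _.
    by rewrite (sphere_fourier F_odd psiP) addrC addKr.
  under eq_bigr do rewrite exchange_big /=.
  rewrite exchange_big; apply: eq_bigr => m _ /=.
  rewrite /fA /fB rmorph_sum big_distrlr /= mulr_sumr; apply: eq_bigr => x _.
  rewrite mulr_sumr; apply: eq_bigr => y _ /=.
  by rewrite addchar_conj // dotBr addcharD.
rewrite -(ler_int algC) rmorphXn rmorphB rmorphM /= -!pmulrn.
have e_real : q%:R * e%:R - (#|A| * #|B|)%:R \is @Num.real algC.
  by rewrite rpredB ?rpredM ?realn.
rewrite -real_normK // eE.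
pose l := sqrtC (4 * q%:R / q%:R ^+ d : algC).
have l2 : l ^+ 2 = 4 * q%:R / q%:R ^+ d by rewrite sqrtCK.
have l_ge0 : 0 <= l by rewrite sqrtC_ge0 divr_ge0 ?mulr_ge0 ?exprn_ge0.
have coef_le (m : 'rV[F]_d) : `|sphere_coef psi r m| <= l.
  rewrite -(@ler_pXn2r _ 2) ?nnegrE // l2 ler_pdivlMr; last first.
    by rewrite exprn_gt0 // lt_neqAle eq_sym q_neq0 /=.
  apply: radial_coef_bound => //; rewrite mulf_neq0 ?invr_neq0 //.
  by rewrite (natrM _ 2 2) mulf_neq0 ?odd_card_natr2_neq0.
have norm_le : `|\sum_m sphere_coef psi r m * (fA m * (fB m)^*)|
             <= l * \sum_m `|fA m| * `|fB m|.
  apply: le_trans (ler_norm_sum _ _ _) _; rewrite mulr_sumr; apply: ler_sum => m _.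
  by rewrite !normrM norm_conjC ler_wpM2r ?mulr_ge0.
apply: (@le_trans _ _ ((l * \sum_m `|fA m| * `|fB m|) ^+ 2)).
  rewrite ler_pXn2r ?nnegrE // mulr_ge0 // sumr_ge0 // => m _.
  by rewrite mulr_ge0.
rewrite exprMn l2.
apply: (@le_trans _ _ (4 * q%:R / q%:R ^+ d
                       * ((q%:R ^+ d * #|A|%:R) * (q%:R ^+ d * #|B|%:R)))).
  rewrite ler_wpM2l ?divr_ge0 ?mulr_ge0 ?exprn_ge0 // -!(sum_dot_norm psiP).
  by apply: cauchy_schwarz_sum => m; exact: normr_real.
rewrite !natrM natrX exprS le_eqVlt; apply/orP; left; apply/eqP.
by field; rewrite expf_neq0.
Qed.

(** * Pruning the vertices of low degree *)

(** Deleting further points only lowers degrees, so a point that was blamed for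
    low degree when it was deleted still has low degree into the final set. *)
Lemma pruning (V I : finType) (R : {set I}) (adj : I -> rel V) (S : {set V})
    (low : pred nat) (k : nat) :
  (forall m n, (m <= n)%N -> low n -> low m) ->
  let deg r x (W : {set V}) := #|[set y in W | adj r x y]| in
  (exists W : {set V}, [/\ W \subset S, (#|S| <= #|W| + k)%N
      & forall x r, x \in W -> r \in R -> ~~ low (deg r x W)])
  \/ (exists (B : {set V}) (rho : V -> I), [/\ B \subset S, #|B| = k
      & forall b, b \in B -> rho b \in R /\ low (deg (rho b) b (S :\: B))]).
Proof.
move=> low_anti deg; elim: k => [|k [[W [WS W_ge W_good]]|[B [rho [BS B_card B_bad]]]]].
(* The assignment [rho] needs a radius as a value; if [R] or [S] is empty, then
   [S] itself will do. *)
- have [x0|V0] := pickP (mem S); last first.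
    left; exists S; split=> [||x r]; rewrite ?addn0 // => xS.
    by have := V0 x; rewrite /= xS.
  case: (pickP (mem R)) => [r0 r0R|R0] x0S; last first.
    left; exists S; split=> [||x r]; rewrite ?addn0 // => _ rR.
    by have := R0 r; rewrite /= rR.
  right; exists set0, (fun=> r0); rewrite sub0set cards0; split=> // b.
  by rewrite inE.
- by left; exists W; split=> //; rewrite addnS (leq_trans W_ge).
have WE : (#|S| = #|S :\: B| + k)%N.
  by rewrite -B_card cardsD (setIidPr BS) subnK // subset_leq_card.
case: (boolP [forall x in S :\: B, forall r in R, ~~ low (deg r x (S :\: B))]).
  move=> /'forall_in_'forall_in_idP good; left; exists (S :\: B); split.
  - exact: subsetDl.
  - by rewrite WE addnS.
  - by move=> x r xW rR; apply: good.
rewrite negb_forall => /existsP[x]; rewrite negb_imply negb_forall => /andP[xW /existsP[r]].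
rewrite negb_imply negbK => /andP[rR x_low]; right.
have deg_le r' y : (deg r' y (S :\: (x |: B)) <= deg r' y (S :\: B))%N.
  apply: subset_leq_card; apply/subsetP => u; rewrite !inE negb_or.
  by move=> /andP[/andP[/andP[_ ->] ->] ->].
exists (x |: B), (fun y => if y == x then r else rho y); split.
- by rewrite subUset BS sub1set andbT; case/setDP: xW.
- by rewrite cardsU1 B_card; case/setDP: xW => _ ->.
- move=> b; rewrite !inE; case: eqVneq => [-> _|_ /= bB].
    by split=> //; apply: low_anti x_low.
  by have [rhoR b_low] := B_bad b bB; split=> //; apply: low_anti b_low.
Qed.

(** For [e] the number of pairs, [q e <= #|B| s / 6] forces
    [#|B| #|W| - q e >= #|B| (6 #|W| - s) / 6], and the square of the left side is
    bounded by the discrepancy. *)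
Lemma low_degree_card (F : finFieldType) d (r : F) (B W : {set 'rV[F]_d}) (s : nat) :
  odd #|F| -> r != 0 -> (s <= 6 * #|W|)%N ->
  (forall b, b \in B -> 6 * #|F| * #|[set y in W | sqnorm (b - y) == r]| < s)%N ->
  (#|B| * (6 * #|W| - s) ^ 2 <= 144 * #|F| ^ d.+1 * #|W|)%N.
Proof.
move=> F_odd r_neq0 s_le B_low.
have := distance_discrepancy B W F_odd r_neq0.
set e := (\sum_(x in B) _)%N; set q := #|F| in B_low *; set Q := (q ^ d.+1)%N.
have e_le : (6 * q * e <= #|B| * s)%N.
  by rewrite big_distrr -sum_nat_const leq_sum // => b /B_low /ltnW.
case: (posnP #|B|) => [->|]; first by rewrite mul0n.
move: #|B| #|W| e_le s_le => b w e_le s_le b_gt0 disc.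
rewrite -(leq_pmul2l b_gt0).
have [v vE] : exists v, (6 * w - s)%N = v /\ (6 * w = v + s)%N.
  by exists (6 * w - s)%N; rewrite subnK.
case: vE => -> vE.
pose z : int := (b * w)%N%:Z - q%:Z * e%:Z.
have z_ge : (b * v)%N%:Z <= 6 * z.
  by rewrite /z; move: e_le vE; clear; nia.
have z2 : z ^+ 2 <= (4 * Q * (b * w))%N%:Z by rewrite -sqrrN /z opprB.
have : (b * v)%N%:Z ^+ 2 <= (6 * z) ^+ 2.
  by rewrite ler_pXn2r ?nnegrE // (le_trans _ z_ge).
have z36 : (6 * z) ^+ 2 <= 36 * (4 * Q * (b * w))%N%:Z.
  by rewrite exprMn ler_wpM2l.
by move=> /le_trans/(_ z36); clear; nia.
Qed.

Lemma removed_le (s k D : nat) : (0 < s)%N -> (144 * D <= s ^ 2)%N -> (k * s <= 50 * D)%N ->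
  (72 * k <= 25 * s)%N.
Proof.
move=> s_gt0 D_le ks_le; rewrite -(leq_pmul2r s_gt0); move: ks_le D_le; clear; nia.
Qed.

(** From [72 k <= 25 s] one gets [12 (5 s - 6 k) >= 35 s], so the last hypothesis
    implies [k s <= (144^2 / 35^2) D < 17 D], while [k s > 50 D - s >= 49 D]. *)
Lemma pruning_arith (s k D : nat) : (0 < D)%N -> (0 < s)%N -> (s <= D)%N ->
  (72 * k <= 25 * s)%N -> (50 * D < k.+1 * s)%N ->
  (k * (5 * s - 6 * k) ^ 2 <= 144 * D * (s - k))%N -> False.
Proof.
move=> D_gt0 s_gt0 s_le k_le ks_gt.
have : (35 * s <= 12 * (5 * s - 6 * k))%N by move: k_le; clear; lia.
rewrite -leq_sqr expnMn [leqRHS]expnMn => sq_le k_ge.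
have : (k * (1225 * s ^ 2) <= (144 * 144) * D * s)%N.
  apply: leq_trans (leq_mul (leqnn k) sq_le) _.
  move: k_ge; set X := ((_ - _) ^ 2)%N => k_ge.
  have : (k * X <= 144 * D * s)%N by rewrite (leq_trans k_ge) // leq_mul2l leq_subr orbT.
  have -> : (k * (12 ^ 2 * X) = 144 * (k * X))%N by ring.
  have -> : ((144 * 144) * D * s = 144 * (144 * D * s))%N by ring.
  by rewrite leq_mul2l.
have -> : (k * (1225 * s ^ 2) = 1225 * (k * s) * s)%N by ring.
rewrite leq_pmul2r // => ks_le'; move: ks_gt ks_le' s_le D_gt0; clear.
rewrite (mulSn k); move: (k * s)%N => m; lia.
Qed.

Theorem proposition2 (K : rcfType) (F : finFieldType) (q d t : nat)
    (R : {set F}) (S : {set 'rV[F]_d})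
    (hq : #|F| = q) (q_odd : odd q) (hd : (2 <= d)%N)
    (hR : R \subset [set~ 0]) (ht : #|R| = t)
    (hS : 12 * Num.sqrt t%:R * Num.sqrt q%:R ^+ d.+1 <= #|S|%:R :> K) :
  exists W : {set 'rV[F]_d},
    [/\ W \subset S,
        #|S|%:R - 80 * t%:R * q%:R ^+ d.+1 * #|S|%:R^-1 <= #|W|%:R :> K
      & forall (x : 'rV[F]_d) (r : F), x \in W -> r \in R ->
          6^-1 * q%:R^-1 * #|S|%:R
            <= #|[set y in W | sqnorm (x - y) == r]|%:R :> K].
Proof.
have q_gt0 : (0 < q)%N by rewrite -hq ltnW ?finNzRing_gt1.
pose s := #|S|; pose D := (t * q ^ d.+1)%N.
have s_ge : (144 * D <= s ^ 2)%N.
  rewrite -(ler_nat K) natrX natrM /D natrM natrX.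
  have -> : 144 * (t%:R * q%:R ^+ d.+1)
          = (12 * Num.sqrt t%:R * Num.sqrt q%:R ^+ d.+1) ^+ 2 :> K.
    rewrite !exprMn sqr_sqrtr // -exprM mulnC exprM sqr_sqrtr // -mulrA; congr (_ * _).
    by rewrite -natrX.
  by rewrite ler_pXn2r ?nnegrE // !mulr_ge0 ?exprn_ge0 ?sqrtr_ge0.
have [t0|t_gt0] := posnP t.
  exists S; split=> // [|x r _].
    by rewrite t0 mulr0 !mul0r subr0.
  by move/eqP: ht; rewrite t0 cards_eq0 => /eqP ->; rewrite inE.
have D_gt0 : (0 < D)%N by rewrite muln_gt0 t_gt0 expn_gt0 q_gt0.
have s_le : (s <= D)%N.
  apply: (@leq_trans (q ^ d)).
    by rewrite -hq -[d in leqRHS]mul1n -card_mx max_card.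
  by rewrite /D expnS mulnA leq_pmull // muln_gt0 t_gt0.
have s_gt0 : (0 < s)%N.
  by rewrite lt0n; apply: contraTneq s_ge => ->; rewrite exp0n // leqn0 muln_eq0 -lt0n.
(* Well below the allowed [80 D / s], and well above the [17 D / s] that leads to
   a contradiction: as [s <= D], rounding lowers [k s] by at most [D]. *)
pose k := (50 * D %/ s)%N; pose low n := (6 * q * n < s)%N.
have low_anti m n : (m <= n)%N -> low n -> low m.
  by move=> mn; apply: leq_ltn_trans; rewrite leq_mul2l mn orbT.
have [[W [WS W_ge W_good]]|] :=
  @pruning _ _ R (fun r x y => sqnorm (x - y) == r) S low k low_anti.
  exists W; split=> // [|x r xW rR].
    rewrite lerBlDr; apply: (@le_trans _ _ (#|W|%:R + k%:R)).
      by rewrite -natrD ler_nat.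
    rewrite lerD2l ler_pdivlMr ?ltr0n // -natrX -!natrM ler_nat.
    apply: leq_trans (leq_divM _ _) _.
    by rewrite -mulnA leq_mul2r orbT.
  have := W_good x r xW rR; rewrite /low -leqNgt => deg_ge.
  rewrite -mulrA ler_pdivrMl // ler_pdivrMl ?ltr0n // mulrCA mulrA.
  by rewrite -!natrM ler_nat.
case=> B [rho [BS B_card B_bad]]; exfalso.
pose W := S :\: B; have sE : s = (#|W| + k)%N.
  by rewrite -B_card cardsD (setIidPr BS) subnK // subset_leq_card.
have k_le : (72 * k <= 25 * s)%N by apply: removed_le s_ge _ => //; rewrite leq_divM.
have w_ge : (s <= 6 * #|W|)%N by move: sE k_le; clear; lia.
apply: (@pruning_arith s k D) => //; first by rewrite ltn_ceil.
have wE : (6 * #|W| - s = 5 * s - 6 * k)%N by move: sE; clear; lia.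
rewrite -wE -[X in (X * _ <= _)%N]B_card.
have -> : #|B| = (\sum_(r in R) #|[set b in B | rho b == r]|)%N.
  rewrite -sum1_card (partition_big rho (mem R)) /=; last by move=> b /B_bad[].
  by apply: eq_bigr => r _; rewrite sum1dep_card.
rewrite big_distrl /=.
apply: (@leq_trans (\sum_(r in R) 144 * q ^ d.+1 * #|W|)).
  apply: leq_sum => r rR; rewrite -hq; apply: (low_degree_card (r := r)) => //.
  - by rewrite hq.
  - by have := subsetP hR r rR; rewrite !inE.
  - by move=> b; rewrite inE => /andP[/B_bad[_ +] /eqP <-]; rewrite hq.
rewrite sum_nat_const ht (_ : (s - k = #|W|)%N) ?sE ?addnK // /D.
by apply: eq_leq; ring.
Qed.
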